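(* Let $\Omega \subset \mathbb{R}^n$, $n\geq 2$, be a bounded, smooth, strongly convex domain. Let $T>0$, $a\colon\Omega\to \mathbb{R}$, $u_0\in C^1(\overline{\Omega})$ with $u_0=0$ on $\partial\Omega$, and let $u \in C^2_x(\overline{\Omega}) \cap C^1(\overline{\Omega}\times[0,T])$ be a positive solution of $$\begin{cases} u_t - \Delta u = a(x) u - u^2 & \text{in } \Omega \times (0,T], \\ u=0 & \text{on }\partial \Omega\times [0,T], \\ D_x u \cdot \nu >0 & \text{on }\partial \Omega\times [0,T], \\ u =u_0 & \text{on } \overline{\Omega} \times \{0\}, \end{cases}$$ where $\nu$ is the interior normal to $\partial \Omega$. Assume moreover that $u_0$ is $\log$-concave and $a$ is concave. Then $\log(u(\cdot, t))$ is concave for each $t \in (0,T)$. Moreover, if $a\in C^{2,1}(\Omega)$ and $u \in C^{2,1}(\Omega \times (0,T])$, then $\log(u(\cdot, t))$ is strictly concave for each $t \in (0,T)$.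
   Context: Domains $\Omega$ are open. Smooth means $\partial\Omega\in C^{2,\alpha}$; strongly convex means that the second fundamental form of $\partial\Omega$ with respect to its interior normal is positive definite everywhere. A solution is positive when $u>0$ in $\Omega\times(0,T]$. $D_x$ is the spatial gradient. $u\in C^2_x(\overline\Omega)$ means $u(\cdot,t)\in C^2(\overline\Omega)$ for each $t\in(0,T]$. $C^{2,1}(\Omega\times(0,T])$ is the usual parabolic notation (two derivatives in $x$, one in $t$); $a\in C^{2,1}(\Omega)$ is understood by regarding $a$ as a time-independent function in this class. A function $w$ is $\log$-concave if $w>0$ (in $\Omega$) and $\log(w)$ is concave. *)

(* Defs.v *)
From HB Require Import structures.
From mathcomp Require Import all_boot all_order all_algebra.
From mathcomp Require Import all_classical all_reals all_analysis.

Set Implicit Arguments.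
Unset Strict Implicit.
Unset Printing Implicit Defensive.

Import Order.TTheory GRing.Theory Num.Theory.
Import numFieldNormedType.Exports.

Local Open Scope classical_set_scope.
Local Open Scope ring_scope.

Definition boundary (T : topologicalType) (A : set T) : set T :=
  closure A `\` interior A.

(* The library norm on 'rV[R]_n is the sup norm, which induces the usual
   topology; the Euclidean structure, needed for normals and curvature, is: *)
Definition dot (R : realType) n (v w : 'rV[R]_n) : R := (v *m w^T) 0 0.

Definition enorm (R : realType) n (v : 'rV[R]_n) : R := Num.sqrt (dot v v).

Definition grad (R : realType) n (f : 'rV[R]_n -> R) (x : 'rV[R]_n) :
    'rV[R]_n :=
  \row_i 'D_('e_i) f x.

Definition laplacian (R : realType) n (f : 'rV[R]_n -> R) (x : 'rV[R]_n) : R :=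
  \sum_(i < n) 'D_('e_i) ('D_('e_i) f) x.

(* C^k(A) for A open: continuous directional derivatives up to order k, which
   in finite dimension is the same as continuous partial derivatives. *)
Fixpoint Ck (R : realType) (V : normedModType R) (k : nat) (A : set V)
    (f : V -> R) : Prop :=
  {within A, continuous f} /\
  if k is k'.+1 then
    forall v, (forall x, A x -> derivable f x v) /\ Ck k' A ('D_v f)
  else True.

(* C^k of the closure of an open set A: f is continuous on the closure, and
   its derivatives up to order k exist in A and extend continuously to the
   closure. Values of f outside the closure are irrelevant. *)
Fixpoint Ck_closure (R : realType) (V : normedModType R) (k : nat) (A : set V)
    (f : V -> R) : Prop :=
  {within closure A, continuous f} /\
  if k is k'.+1 then
    forall v, (forall x, A x -> derivable f x v) /\
      exists2 g, (forall x, A x -> g x = 'D_v f x) & Ck_closure k' A g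
  else True.

Definition hoelder_on (R : realType) (V : normedModType R) (alpha : R)
    (A : set V) (f : V -> R) : Prop :=
  exists C : R, forall x y, A x -> A y ->
    `|f x - f y| <= C * `|x - y| `^ alpha.

Definition Ck_hoelder2 (R : realType) (V : normedModType R) (alpha : R)
    (A : set V) (f : V -> R) : Prop :=
  Ck 2 A f /\ forall v w, hoelder_on alpha A ('D_w ('D_v f)).

(* Near p, Omega is the set {rho > 0}, with rho of class C^2 and without
   critical points; hence the boundary of Omega is {rho = 0} near p and
   grad rho points into Omega. *)
Definition local_defining (R : realType) n (Omega : set 'rV[R]_n)
    (p : 'rV[R]_n) (U : set 'rV[R]_n) (rho : 'rV[R]_n -> R) : Prop :=
  [/\ open_nbhs p U, Ck 2 U rho, forall x, U x -> grad rho x != 0 &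
      Omega `&` U = [set x | 0 < rho x] `&` U].

Definition boundary_C2alpha (R : realType) n (Omega : set 'rV[R]_n) : Prop :=
  exists2 alpha : R, 0 < alpha < 1 &
    forall p, boundary Omega p -> exists U rho,
      local_defining Omega p U rho /\ Ck_hoelder2 alpha U rho.

(* A unit vector field around p, equal to the interior unit normal of Omega on
   the boundary whenever rho is a local defining function. *)
Definition normal_field (R : realType) n (rho : 'rV[R]_n -> R)
    (x : 'rV[R]_n) : 'rV[R]_n :=
  (enorm (grad rho x))^-1 *: grad rho x.

Definition interior_normal (R : realType) n (Omega : set 'rV[R]_n)
    (p nu : 'rV[R]_n) : Prop :=
  boundary Omega p /\
  exists U rho, local_defining Omega p U rho /\ nu = normal_field rho p.

(* II_p(v, w) = - <D_v N, w> for v, w tangent at p, N being the unit normal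
   field. With the interior normal it is positive definite on spheres. *)
Definition second_fundamental_form (R : realType) n
    (N : 'rV[R]_n -> 'rV[R]_n) (p v w : 'rV[R]_n) : R :=
  - dot ('D_v N p) w.

(* The form does not depend on the local defining function: derivatives of N
   in tangent directions are determined by N on the boundary. *)
Definition strongly_convex (R : realType) n (Omega : set 'rV[R]_n) : Prop :=
  forall p U rho, boundary Omega p -> local_defining Omega p U rho ->
    forall v, v != 0 -> dot v (normal_field rho p) = 0 ->
      0 < second_fundamental_form (normal_field rho) p v v.

(* Time derivative relative to the time set I, i.e., one-sided at an end point
   of I that belongs to I. *)
Definition time_quotient (R : realType) (V : Type) (f : V -> R -> R)
    (x : V) (t s : R) : R :=
  (f x s - f x t) / (s - t).

Definition time_derivable (R : realType) (V : Type) (I : set R)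
    (f : V -> R -> R) (x : V) (t : R) : Prop :=
  cvg (time_quotient f x t s @[s --> within (I `\ t) (nbhs t)]).

Definition time_derive (R : realType) (V : Type) (I : set R)
    (f : V -> R -> R) (x : V) (t : R) : R :=
  lim (time_quotient f x t s @[s --> within (I `\ t) (nbhs t)]).

(* The continuous extension to (p, t) of the spatial gradient of f on A x I. *)
Definition grad_ext (R : realType) n (A : set 'rV[R]_n) (I : set R)
    (f : 'rV[R]_n -> R -> R) (p : 'rV[R]_n) (t : R) : 'rV[R]_n :=
  lim (grad (f ^~ z.2) z.1 @[z --> within (A `*` I) (nbhs (p, t))]).

Definition C21 (R : realType) (V : normedModType R) (A : set V) (I : set R)
    (f : V -> R -> R) : Prop :=
  [/\ forall x t, A x -> I t ->
        time_derivable I f x t /\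
        forall v w, derivable (f ^~ t) x v /\ derivable ('D_v (f ^~ t)) x w,
      {within A `*` I, continuous (fun z => f z.1 z.2)},
      {within A `*` I, continuous (fun z => time_derive I f z.1 z.2)},
      forall v, {within A `*` I, continuous (fun z => 'D_v (f ^~ z.2) z.1)} &
      forall v w, {within A `*` I,
        continuous (fun z => 'D_w ('D_v (f ^~ z.2)) z.1)}].

Definition concave_on (R : realType) (V : lmodType R) (A : set V)
    (f : V -> R) : Prop :=
  @convex_function R V A (fun x => - f x).

Definition strictly_concave_on (R : realType) (V : lmodType R) (A : set V)
    (f : V -> R) : Prop :=
  forall (x y : V) (l : R), A x -> A y -> x != y -> 0 < l < 1 ->
    l * f x + (1 - l) * f y < f (l *: x + (1 - l) *: y).

Definition log_concave_on (R : realType) (V : lmodType R) (A : set V)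
    (w : V -> R) : Prop :=
  (forall x, A x -> 0 < w x) /\ concave_on A (fun x => ln (w x)).

(* Main.v *)
Require Import Defs.
From mathcomp Require Import all_boot all_order all_algebra.
From mathcomp Require Import all_classical all_reals all_analysis.
From mathcomp Require Import ring lra.

(* Write [v = ln u], so that [v_t = Lap v + |Dv|^2 + a - exp v].

   Concavity.  Fix [l] and put [z = l x + (1 - l) y].  Instead of the concavity
   defect of [v], which is singular on the boundary, minimise
   [exp (- K t) (u(z) - u(x)^l u(y)^(1-l))] over the compact set of all
   [x], [y] in the closure of Omega and [t] in [0, t0], where [K] bounds [a]
   from above.  The bracket is nonnegative when [x] or [y] lies on the boundary
   and when [t = 0], so a negative minimum is interior, where the first and
   second order conditions contradict the equation.  Omega is convex by the sign
   of the curvature, because a limit of segments of Omega cannot touch the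
   boundary at an interior point.

   Strict concavity.  The defect [C = v(z) - l v(x) - (1 - l) v(y)] is positive
   when [x] is close to the boundary.  Starting from a translate
   [(x + s (x - y), y + s (x - y))] with this property at time [t / 2], a
   positive subsolution supported in a ball which moves back to [z] stays below
   [C].  Since [C] only satisfies a differential inequality in the directions
   [(e, e)], a penalty in [x - y] controls the remaining gradient terms. *)

Set Implicit Arguments.
Unset Strict Implicit.
Unset Printing Implicit Defensive.

Import Order.TTheory GRing.Theory Num.Theory.
Import numFieldNormedType.Exports.

Local Open Scope classical_set_scope.
Local Open Scope ring_scope.

(** * Derivatives along lines *)

(** The equation supplies diffusion only along the diagonal directions [(e, e)] of the space of
    pairs. For preservation this is enough: stationarity in [x] and in [y] separately relates the
    three gradients, which disposes of the quadratic terms. For strictness it is the obstacle, since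
    no strong maximum principle applies directly in [(x, y)]. In the coordinates
    [m = l x + (1 - l) y] and [d = x - y] the diffusion acts on [m] alone, and the defect of
    [|Dv|^2] contains the unfavourable term [- l (1 - l) |Dv(x) - Dv(y)|^2], which no derivative in
    [m] controls. With the penalty [N |d - d0|^2], stationarity in [d] reads
    [l (1 - l) (Dv(x) - Dv(y)) = 2 N (d - d0)], and at a negative minimum the penalty is itself at
    most the barrier. The bad term thus becomes a multiple of the barrier, of order zero, and a fast
    decay in time absorbs it. The bound [K] is not assumed: a concave function on a bounded convex
    domain is bounded above as soon as it is bounded below near one point. *)

Lemma is_derive_line (R : realType) (V W : normedModType R) (f : V -> W)
    (x v : V) (s : R) (df : W) :
  is_derive (x + s *: v) v f df -> is_derive s 1 (fun r => f (x + r *: v)) df.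
Proof.
have E : (fun h : R => h^-1 *: (f (x + (h *: 1 + s) *: v) - f (x + s *: v)))
       = (fun h => h^-1 *: ((f \o shift (x + s *: v)) (h *: v) - f (x + s *: v))).
  by apply/funext => h /=; rewrite [h *: 1]mulr1 scalerDl addrCA.
move=> [d1 d2]; apply: DeriveDef; first by rewrite /derivable E.
by rewrite /derive E.
Qed.

Lemma is_derive_line_scale (R : realType) (V : normedModType R) (f : V -> R)
    (x v : V) (s c df : R) :
  is_derive (x + (c * s) *: v) v f df ->
  is_derive s 1 (fun r => f (x + (c * r) *: v)) (c * df).
Proof.
move=> /is_derive_line fd.
have cd : is_derive s 1 (fun r : R => c * r) c.
  by apply: is_derive_eq; rewrite ?[_ *: _]mulr1 ?mulr1.
by have := is_derive1_comp fd cd; rewrite [c * df]mulrC.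
Qed.

(** One-sided because a space-time minimum may sit at the last time of the compact time interval,
    where only earlier times can be compared. *)
Lemma left_min_derive_le0 (R : realType) (f : R -> R) (c df : R) :
  is_derive c 1 f df -> (\forall s \near c^'-, f c <= f s) -> df <= 0.
Proof.
move=> [fd <-] fmin; rewrite ['D_1 f c]cvg_at_leftE//.
apply: limr_le.
  rewrite -(cvg_at_leftE (fun h => h^-1 *: ((f \o shift c) _ - f c))) //.
  apply: cvg_trans fd; apply: cvg_app.
  by move=> A [e egt0 Ae]; exists e => // x xe xgt0; apply: Ae => //; exact/ltr0_neq0.
have [e /= e0 He] := fmin.
near=> h; apply: mulr_le0_ge0.
  by rewrite invr_le0 ltW//; near: h; exists 1 => /=.
rewrite subr_ge0 [_%:A]mulr1 /=; apply: He => /=; last first.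
  by rewrite -ltrBrDr subrr; near: h; exists 1 => /=.
rewrite opprD addrCA subrr addr0 normrN; near: h.
exists e => //= h; rewrite /ball_ /= sub0r normrN.
Unshelve. all: by end_near. Qed.

Lemma local_min_derive_eq0 (R : realType) (f : R -> R) (c df : R) :
  is_derive c 1 f df -> (\forall s \near c, f c <= f s) -> df = 0.
Proof.
move=> fd fmin; apply/eqP; rewrite eq_le; apply/andP; split.
  by apply: (left_min_derive_le0 fd); exact: cvg_within fmin.
rewrite -oppr_le0.
have Nd : is_derive (- c) 1 (f \o -%R) (- df).
  have := @is_derive1_comp R f -%R (- c) df (-1).
  by rewrite mulrN1; apply; rewrite opprK.
apply: (left_min_derive_le0 Nd); apply: cvg_within.
have [e /= e0 He] := fmin; exists e => //= s; rewrite opprK => se; apply: He.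
by move: se; rewrite /ball_ /= opprK -opprD normrN.
Qed.

(* If [L < 0] then [f'] is negative just to the right of [0], so the mean value
   theorem contradicts minimality. *)
Lemma second_order_min (R : realType) (f f' : R -> R) (L : R) :
  (\forall s \near (0 : R), is_derive (s : R) (1 : R) f (f' s)) ->
  is_derive (0 : R) (1 : R) f' L ->
  (\forall s \near (0 : R), f 0 <= f s) -> f' 0 = 0 /\ 0 <= L.
Proof.
move=> fd f'd fmin.
have f'0 : f' 0 = 0 by apply: (local_min_derive_eq0 (nbhs_singleton fd)).
split=> //; rewrite leNgt; apply/negP => L0.
have nneg : \forall h \near (0 : R)^', h^-1 * f' h < 0.
  have [ex ev] := f'd; move: ex; rewrite /derivable => ex.
  have : h^-1 *: ((f' \o shift 0) (h *: 1) - f' 0) @[h --> (0:R)^'] --> L.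
    by rewrite -ev; exact: ex.
  move=> /(cvgr_lt L)/(_ _ L0); apply: filterS => h /=.
  by rewrite f'0 subr0 addr0 [h *: 1]mulr1.
have {}nneg : \forall h \near (0 : R), 0 < h -> f' h < 0.
  move: nneg; rewrite near_withinE; apply: filterS => h + h0.
  by move/(_ (lt0r_neq0 h0)); rewrite pmulr_rlt0// invr_gt0.
have : \forall h \near (0 : R),
    [/\ is_derive (h : R) (1 : R) f (f' h), f 0 <= f h & 0 < h -> f' h < 0].
  by near=> h; split; near: h.
move=> [e /= e0 He].
have He' h : `|h| < e -> [/\ is_derive (h : R) (1 : R) f (f' h), f 0 <= f h & 0 < h -> f' h < 0].
  by move=> hl; apply: He; rewrite /= sub0r normrN.
have e20 : 0 < e / 2 by rewrite divr_gt0.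
have ele : e / 2 < e by lra.
have [||c] := @MVT R f f' 0 (e / 2) e20.
- move=> x; rewrite in_itv/= => /andP[x0 xe].
  suff /He'[] : `|x| < e by [].
  by rewrite gtr0_norm// (lt_trans xe).
- apply: derivable_within_continuous => x; rewrite in_itv/= => /andP[x0 xe].
  suff /He'[[]] : `|x| < e by [].
  by rewrite ger0_norm// (le_lt_trans xe).
rewrite in_itv/= => /andP[c0 ce] E.
have [_ _ /(_ c0) f'c] : [/\ is_derive c 1 f (f' c), f 0 <= f c & 0 < c -> f' c < 0].
  by apply: He'; rewrite gtr0_norm// (lt_trans ce).
have [_ fm _] : [/\ is_derive (e/2) 1 f (f' (e/2)), f 0 <= f (e/2) & 0 < e/2 -> f' (e/2) < 0].
  by apply: He'; rewrite gtr0_norm.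
have : f' c * (e / 2 - 0) < 0 by rewrite pmulr_llt0// subr0.
by rewrite -E subr_lt0 ltNge fm.
Unshelve. all: by end_near. Qed.

Lemma is_derive_dirZ (R : realType) (V : normedModType R) (f : V -> R)
    (x v : V) (c df : R) :
  is_derive x v f df -> is_derive x (c *: v) f (c * df).
Proof.
move=> fd.
have := @is_derive_line_scale R V f x v 0 c df.
rewrite mulr0 scale0r addr0 => /(_ fd)[d1 d2].
have E : (fun h : R => h^-1 *: (f (x + (c * (h *: 1 + 0)) *: v) - f (x + (c * 0) *: v)))
       = (fun h => h^-1 *: ((f \o shift x) (h *: (c *: v)) - f x)).
  apply/funext => h /=; rewrite [h *: 1]mulr1 addr0 mulr0 scale0r addr0.
  by rewrite scalerA [c * h]mulrC [x + _]addrC.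
by apply: DeriveDef; [rewrite /derivable -E|rewrite /derive -E].
Qed.

(** Existence of directional derivatives does not make them additive in the direction; continuity of
    ['D_w f] does. The mean value theorem on the segment from [x + h v] to [x + h v + h w] writes
    the second increment as [h] times a value of ['D_w f] at a point tending to [x]. *)
Lemma is_derive_dirD (R : realType) (V : normedModType R) (f : V -> R)
    (x v w : V) (a : R) :
  is_derive x v f a -> (\forall y \near x, derivable f y w) ->
  {for x, continuous ('D_w f)} -> is_derive x (v + w) f (a + 'D_w f x).
Proof.
move=> fv fw cw; set b := 'D_w f x.
have key : h^-1 * (f (x + h *: v + h *: w) - f (x + h *: v)) @[h --> (0 : R)^'] --> b.
  apply/cvgrPdist_lt => e e0.
  have : \forall y \near x, derivable f y w /\ `|b - 'D_w f y| < e.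
    near=> y; split; near: y => //.
    by move/cvgrPdist_lt : cw; apply.
  move=> /nbhs_ballP[d /= d0 Hd].
  near=> h.
  have Hb (c : R) : 0 <= c -> c <= 1 -> ball x d (x + h *: v + (c * h) *: w).
    move=> c0 c1; rewrite -ball_normE /= opprD addrA opprD addrA subrr sub0r -opprD normrN.
    apply: (@le_lt_trans _ _ (`|h| * (`|v| + `|w|))).
      rewrite (le_trans (ler_normD _ _))// !normrZ mulrDr lerD2l ler_wpM2r//.
      by rewrite (ger0_norm c0) ler_piMl.
    apply: (@le_lt_trans _ _ (`|h| * (`|v| + `|w| + 1))).
      by rewrite ler_wpM2l// lerDl.
    rewrite -ltr_pdivlMr; last by rewrite ltr_wpDl// addr_ge0.
    near: h; apply: dnbhs0_lt; rewrite divr_gt0// ltr_wpDl// addr_ge0//.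
  have h0 : h != 0 by near: h; exact: nbhs_dnbhs_neq.
  have gd (c : R) : 0 <= c -> c <= 1 ->
     is_derive (c : R) (1 : R) (fun c : R => f (x + h *: v + (h * c) *: w))
       (h * 'D_w f (x + h *: v + (h * c) *: w)).
    move=> c0 c1; apply: is_derive_line_scale; apply: derivableP.
    by apply: (Hd _ _).1; rewrite [h * c]mulrC; exact: Hb.
  have [||c] := @MVT R (fun c : R => f (x + h *: v + (h * c) *: w))
      (fun c : R => h * 'D_w f (x + h *: v + (h * c) *: w)) 0 1 ltr01.
  - by move=> c; rewrite in_itv/= => /andP[c0 c1]; apply: gd; exact: ltW.
  - apply: derivable_within_continuous => c; rewrite in_itv/= => /andP[c0 c1].
    by have [] := gd c c0 c1.
  rewrite in_itv/= => /andP[c0 c1].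
  rewrite mulr1 mulr0 scale0r addr0 subr0 mulr1 => ->.
  rewrite mulKf// [h * c]mulrC.
  by have [] := Hd _ (Hb c (ltW c0) (ltW c1)).
have [ex ev] := fv.
have vlim : h^-1 *: ((f \o shift x) (h *: v) - f x) @[h --> (0 : R)^'] --> a.
  by rewrite -ev; exact: ex.
have E : (fun h : R => h^-1 *: ((f \o shift x) (h *: (v + w)) - f x)) =
    (fun h : R => h^-1 *: ((f \o shift x) (h *: v) - f x)) \+
    (fun h : R => h^-1 * (f (x + h *: v + h *: w) - f (x + h *: v))).
  apply/funext => h /=; rewrite /GRing.scale /= -mulrDr; congr (_ * _).
  have -> : h *: (v + w) + x = x + h *: v + h *: w by rewrite scalerDr addrC addrA.
  by rewrite [h *: v + x]addrC [RHS]addrC [RHS]addrA subrK.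
have slim : h^-1 *: ((f \o shift x) (h *: (v + w)) - f x) @[h --> (0 : R)^'] --> a + b.
  by rewrite E; exact: (cvgD vlim key).
apply: DeriveDef; first by apply/cvg_ex; exists (a + b).
exact: cvg_lim.
Unshelve. all: by end_near. Qed.

(** [grad] only records partial derivatives, so [v] is expanded in the standard basis and its
    components are added one direction at a time. *)
Lemma is_derive_row (R : realType) n (f : 'rV[R]_n -> R) (U : set 'rV[R]_n)
    (x v : 'rV[R]_n) :
  open U -> Ck 1 U f -> U x -> is_derive x v f (dot (grad f x) v).
Proof.
move=> oU [_ cf] Ux.
have fd i : is_derive x (v ord0 i *: 'e_i) f (v ord0 i * 'D_('e_i) f x).
  by apply: is_derive_dirZ; apply: derivableP; exact: (cf _).1.
have -> : dot (grad f x) v = \sum_i v ord0 i * 'D_('e_i) f x.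
  by rewrite /dot mxE; apply: eq_bigr => i _; rewrite !mxE mulrC.
rewrite [in X in is_derive _ X](row_sum_delta v).
elim: (index_enum _) => [|i r IH]; first by rewrite !big_nil; exact: is_derive0.
rewrite !big_cons addrC [_ + \sum_(j <- r) _]addrC -(@derive_val _ _ _ _ _ _ _ (fd i)).
apply: is_derive_dirD => //.
  by near do apply: (cf _).1; exact: open_nbhs_nbhs.
have [_ []] := cf (v ord0 i *: 'e_i).
by rewrite continuous_open_subspace// => /(_ x (mem_set Ux)).
Unshelve. all: by end_near. Qed.

(** * Convexity of the domain *)

Lemma near_line_open (R : realType) (V : normedModType R) (U : set V) (x v : V) :
  open U -> U x -> \forall s \near (0 : R), U (x + s *: v).
Proof.
move=> oU Ux.
have : (fun s : R => x + s *: v) @ (0 : R) --> x + (0 : R) *: v.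
  by apply: cvgD; [exact: cvg_cst|apply: cvgZr_tmp; exact: cvg_id].
by rewrite scale0r addr0; apply; exact: open_nbhs_nbhs.
Qed.

Lemma is_derive_comp_real (R : realType) (V : normedModType R) (g : R -> R)
    (f : V -> R) (x v : V) (a b : R) :
  is_derive (f x) (1 : R) g a -> is_derive x v f b ->
  is_derive x v (fun y => g (f y)) (a * b).
Proof.
move=> gd fd.
have fd0 : is_derive (0 : R) (1 : R) (fun r => f (x + r *: v)) b.
  by apply: is_derive_line; rewrite scale0r addr0.
have gd0 : is_derive (f (x + (0 : R) *: v)) (1 : R) g a by rewrite scale0r addr0.
have [d1 d2] := is_derive1_comp gd0 fd0.
have E : (fun h : R => h^-1 *: (g (f (x + (h *: (1 : R) + 0) *: v)) - g (f (x + (0 : R) *: v))))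
       = (fun h => h^-1 *: (((fun y => g (f y)) \o shift x) (h *: v) - g (f x))).
  by apply/funext => h /=; rewrite [h *: 1]mulr1 addr0 scale0r addr0 [x + _]addrC.
by apply: DeriveDef; [rewrite /derivable -E|rewrite /derive -E].
Qed.

Lemma dotE (R : realType) n (v w : 'rV[R]_n) :
  dot v w = \sum_i v ord0 i * w ord0 i.
Proof. by rewrite /dot mxE; apply: eq_bigr => i _; rewrite mxE. Qed.

Lemma dot_ge0 (R : realType) n (x : 'rV[R]_n) : 0 <= dot x x.
Proof. by rewrite dotE sumr_ge0// => i _; rewrite -expr2 sqr_ge0. Qed.

Lemma dot_gt0 (R : realType) n (v : 'rV[R]_n) : v != 0 -> 0 < dot v v.
Proof.
move=> v0; rewrite lt_neqAle dot_ge0 andbT dotE.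
apply: contra v0; rewrite eq_sym psumr_eq0 => [/allP v0|i _]; last first.
  by rewrite -expr2 sqr_ge0.
apply/eqP/rowP => i; rewrite mxE; apply/eqP.
by have := v0 i (mem_index_enum _); rewrite /= -expr2 sqrf_eq0.
Qed.

(* A segment of the closure touching the boundary at an interior point [p] would
   make [rho] minimal at [p] along [v], against the sign of the curvature. *)
Lemma strongly_convex_no_tangency (R : realType) n (Omega : set 'rV[R]_n)
    (p v : 'rV[R]_n) :
  open Omega -> boundary_C2alpha Omega -> strongly_convex Omega ->
  ~ Omega p -> v != 0 -> (\forall s \near (0 : R), closure Omega (p + s *: v)) ->
  False.
Proof.
move=> oO [alpha _ smooth] cvx np v0 seg.
have bp : boundary Omega p.
  split; last by rewrite /= (interior_id _).1.
  by have := nbhs_singleton seg; rewrite scale0r addr0.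
have [U [rho [ld _]]] := smooth p bp.
have [[oU Up] C2rho g0 OU] := ld.
have crho y : U y -> {for y, continuous rho}.
  move=> Uy; have [c0 _] := C2rho.
  by move: c0; rewrite continuous_open_subspace// => /(_ y (mem_set Uy)).
(* Where [rho < 0], a whole neighbourhood misses Omega, so such a point is not in the closure. *)
have rho_ge0 y : U y -> closure Omega y -> 0 <= rho y.
  move=> Uy cy; rewrite leNgt; apply/negP => ry.
  have /cy[z [Oz [Uz]]] : nbhs y (U `&` [set z | rho z < 0]).
    apply: filterI; first exact: open_nbhs_nbhs.
    exact: (cvgr_lt (rho y) (crho y Uy) 0 ry).
  have : (Omega `&` U) z by [].
  by rewrite OU => -[/= /ltW]; rewrite leNgt => /negP.
have rp : rho p = 0.
  apply/eqP; rewrite eq_le rho_ge0//; last by case: bp.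
  rewrite andbT leNgt; apply/negP => r0.
  have : ([set x | 0 < rho x] `&` U) p by [].
  by rewrite -OU => -[].
have C1rho : Ck 1 U rho.
  case: C2rho => crho' C2rho; split=> // w; have [? [? _]] := C2rho w; split=> //.
have pU := near_line_open v oU Up.
(* [L] is the Hessian of [rho] at [p] evaluated on [(v, v)]. *)
pose L := \sum_i 'D_v ('D_('e_i) rho) p * v ord0 i.
have D2 i : is_derive p v ('D_('e_i) rho) ('D_v ('D_('e_i) rho) p).
  apply: derivableP; have [_ C2] := C2rho; have [_ [_ C1]] := C2 'e_i.
  by have [dv _] := C1 v; exact: dv.
have rmin : \forall s \near (0 : R), rho (p + (0 : R) *: v) <= rho (p + s *: v).
  by near=> s; rewrite scale0r addr0 rp; apply: rho_ge0; near: s.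
have [||] := second_order_min (f := fun s => rho (p + s *: v))
  (f' := fun s => dot (grad rho (p + s *: v)) v) (L := L) _ _ rmin.
- near=> s; apply: is_derive_line. refine (@is_derive_row R n rho U (p + s *: v) v oU C1rho _).
  by near: s.
- apply: (@is_derive_line _ _ _ (fun x => dot (grad rho x) v)).
  rewrite scale0r addr0.
  have -> : (fun x => dot (grad rho x) v) = \sum_i (fun x => 'D_('e_i) rho x * v ord0 i).
    apply/funext => x; rewrite dotE fct_sumE; apply: eq_bigr => i _.
    by rewrite mxE.
  apply: is_derive_sum => i.
  have -> : (fun x => 'D_('e_i) rho x * v ord0 i) = v ord0 i *: 'D_('e_i) rho.
    by apply/funext => x; rewrite mulrC.
  by rewrite mulrC; exact: (is_deriveZ _ (D2 i)).
rewrite scale0r addr0 => gv0 L0.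
have gp0 := dot_gt0 (g0 p Up).
pose k (x : 'rV[R]_n) := (enorm (grad rho x))^-1.
have k0 : 0 < k p by rewrite invr_gt0 sqrtr_gt0.
have [k' kd] : exists k', is_derive p v k k'.
  have [q qd] : exists q, is_derive p v (fun x => dot (grad rho x) (grad rho x)) q.
    have -> : (fun x => dot (grad rho x) (grad rho x)) =
              \sum_i (fun x => 'D_('e_i) rho x * 'D_('e_i) rho x).
      apply/funext => x; rewrite dotE fct_sumE; apply: eq_bigr => i _.
      by rewrite mxE.
    eexists; apply: is_derive_sum => i; exact: (is_deriveM (D2 i) (D2 i)).
  have sd := @is_derive_comp_real _ _ Num.sqrt
    (fun x => dot (grad rho x) (grad rho x)) p v _ q (is_derive1_sqrt gp0) qd.
  eexists; apply: derivableP; apply: derivableV; first by rewrite gt_eqF// sqrtr_gt0.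
  by case: sd.
have Nd i : is_derive p v (fun x => normal_field rho x ord0 i)
    (k p * 'D_v ('D_('e_i) rho) p + 'D_('e_i) rho p * k').
  have -> : (fun x => normal_field rho x ord0 i) = k * 'D_('e_i) rho.
    by apply/funext => x; rewrite !mxE.
  exact: (is_deriveM kd (D2 i)).
have Ndv : derivable (normal_field rho) p v.
  by apply/derivable_mxP => i j; rewrite ord1; case: (Nd j).
have vN : dot v (normal_field rho p) = 0.
  have -> : dot v (normal_field rho p) = k p * dot (grad rho p) v.
    rewrite !dotE mulr_sumr; apply: eq_bigr => i _.
    by rewrite !mxE mulrC -mulrA.
  by rewrite gv0 mulr0.
have := cvx p U rho bp ld v v0 vN.
rewrite /second_fundamental_form oppr_gt0 derive_mx// dotE ltNge => /negP; apply.
(* With [N = k grad rho], the product rule gives [<D_v N, v> = k L + k' <grad rho, v>]. As [v] is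
   tangent, only [k L >= 0] remains, so the curvature along [v] is not positive. *)
have -> : \sum_i (\matrix_(i0, j) 'D_v (fun t => normal_field rho t i0 j) p) ord0 i * v ord0 i
   = k p * L + k' * dot (grad rho p) v.
  rewrite /L dotE !mulr_sumr -big_split; apply: eq_bigr => i _ /=.
  by rewrite !mxE (@derive_val _ _ _ _ _ _ _ (Nd i)); ring.
by rewrite gv0 mulr0 addr0 mulr_ge0// ltW.
Unshelve. all: by end_near. Qed.

Lemma compact_open_thickening (R : realType) (V : normedModType R) (K U : set V) :
  compact K -> open U -> K `<=` U ->
  exists2 r : R, 0 < r & forall x y, K x -> `|x - y| <= r -> U y.
Proof.
move=> /compact_near_coveringP cK oU KU.
have : \forall r \near (0 : R)^'+, K `<=` [set x | forall y, `|x - y| <= r -> U y].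
  apply: (cK R _ (fun r x => forall y, `|x - y| <= r -> U y)) => x Kx.
  have /nbhs_ballP[d /= d0 dU] : nbhs x U by apply: open_nbhs_nbhs; split=> //; exact: KU.
  exists (ball x (d / 2), [set r | r < d / 2]) => /=.
    split; first by apply: nbhsx_ballx; rewrite divr_gt0.
    by apply: nbhs_right_lt; rewrite divr_gt0.
  move=> [x' r] /= []; rewrite -ball_normE /= => xx' rd y yr; apply: dU.
  rewrite -ball_normE /=; rewrite -(subrKA x') (splitr d).
  by rewrite (le_lt_trans (ler_normD _ _))// ltrD// (le_lt_trans yr).
move=> H; near (0 : R)^'+ => r.
exists r => // x y Kx xy.
suff /(_ x Kx y xy) : K `<=` [set x | forall y, `|x - y| <= r -> U y] by [].
by near: r.
Unshelve. all: by end_near. Qed.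

Definition segment_point (R : realType) (V : lmodType R) (x y : V) (l : R) :=
  l *: x + (1 - l) *: y.

Lemma segment_point_continuous (R : realType) (V : normedModType R) (x y : V) :
  continuous (segment_point x y).
Proof.
move=> l; apply: cvgD; first by apply: cvgZr_tmp; exact: cvg_id.
by apply: cvgZr_tmp; apply: cvgB; [exact: cvg_cst|exact: cvg_id].
Qed.

Lemma segment_point_continuousr (R : realType) (V : normedModType R) (x : V) (l : R) :
  continuous (fun y => segment_point x y l).
Proof.
by move=> y; apply: cvgD; [exact: cvg_cst|apply: cvgZl_tmp; exact: cvg_id].
Qed.

Lemma segment_compact_image (R : realType) (V : normedModType R) (x y : V) :
  compact (segment_point x y @` `[0, 1]).
Proof.
apply: continuous_compact; last exact: segment_compact.
by apply: continuous_subspaceT; exact: segment_point_continuous.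
Qed.

(** The points whose segment from [x] lies in Omega form a nonempty, open and relatively closed
    subset of the connected set Omega. *)
Lemma strongly_convex_segment (R : realType) n (Omega : set 'rV[R]_n) (x y : 'rV[R]_n) (l : R) :
  open Omega -> connected Omega -> boundary_C2alpha Omega ->
  strongly_convex Omega -> Omega x -> Omega y -> 0 <= l <= 1 ->
  Omega (segment_point x y l).
Proof.
move=> oO conn smooth cvx Ox Oy l01.
pose S := [set y | Omega y /\ forall l, 0 <= l <= 1 -> Omega (segment_point x y l)].
suff OS : Omega = S by move: Oy; rewrite {1}OS => -[_]; exact.
apply/esym/conn.
- exists x; split=> // k _.
  by rewrite /segment_point -scalerDl addrCA subrr addr0 scale1r.
(* Openness: the segment is compact, so it has a uniform thickening inside Omega, and moving the far
   end by at most [r] moves each of its points by at most [r]. *)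
- exists S; last by rewrite setIidr// => z [].
  rewrite openE => z [Oz Sz].
  have [|r r0 Hr] := compact_open_thickening (@segment_compact_image _ _ x z) oO.
    by move=> _ [k + <-]; rewrite /= in_itv/=; exact: Sz.
  near=> z'.
  have zz' : `|z - z'| <= r.
    by near: z'; apply: cvgr_dist_le r0; exact: cvg_id.
  have Hz' k : 0 <= k <= 1 -> Omega (segment_point x z' k).
    move=> k01; apply: Hr; first by exists k; [rewrite /= in_itv|].
    rewrite /segment_point opprD addrACA subrr add0r -scalerBr normrZ.
    have /andP[k0 k1] := k01.
    by rewrite ger0_norm ?subr_ge0// (le_trans _ zz')// ler_piMl// lerBlDr lerDl.
  split=> //; have := Hz' 0; rewrite /segment_point scale0r add0r subr0 scale1r.
  by apply; rewrite lexx ler01.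
- exists (closure S); first exact: closed_closure.
  apply/seteqP; split=> [z Sz|z [Oz cz]]; first by split; [case: Sz|exact: subset_closure].
  split=> //.
  have cl k : 0 <= k <= 1 -> closure Omega (segment_point x z k).
    move=> k01 B nB.
    have cont := @segment_point_continuousr R _ x k z.
    have [w [[Ow Sw] Bw]] := cz _ (cont _ nB).
    by exists (segment_point x w k); split=> //; exact: Sw.
  move=> k /andP[k0 k1].
  have [->|k1'] := eqVneq k 1; first by rewrite /segment_point subrr scale0r addr0 scale1r.
  have [->|k0'] := eqVneq k 0; first by rewrite /segment_point subr0 scale0r add0r scale1r.
  have [xz|xz] := eqVneq x z.
    by rewrite /segment_point xz -scalerDl addrCA subrr addr0 scale1r.
  apply: contrapT => np; rewrite -subr_eq0 in xz.
  apply: (strongly_convex_no_tangency oO smooth cvx np xz).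
  (* Both [0 < k] and [k < 1] are strict, so a short piece of the line on either side of the contact
     point still belongs to the limit segment. *)
  have k0s : 0 < k by rewrite lt_neqAle eq_sym k0'.
  have k1s : k < 1 by rewrite lt_neqAle k1'.
  near=> s.
  have -> : segment_point x z k + s *: (x - z) = segment_point x z (k + s).
    rewrite /segment_point opprD addrA scalerBr [in RHS]scalerDl.
    by rewrite [(1 - k - s) *: z]scalerBl addrACA.
  have : `|s| < k by near: s; exact: (@nbhs0_lt R R k).
  have : `|s| < 1 - k by near: s; apply: (@nbhs0_lt R R (1 - k)); rewrite subr_gt0.
  rewrite !ltr_norml => /andP[_ s1] /andP[s0 _]; apply: cl.
  by apply/andP; split; lra.
Unshelve. all: by end_near. Qed.

(** * The equation for the logarithm *)

(** Only derivatives along the coordinate axes and two-sided time derivatives at interior times are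
    recorded, which is all that the minimum conditions use. The square of the gradient comes from
    [Lap u / u = Lap v + |Dv|^2]. *)
Definition log_solution (R : realType) n (Omega : set 'rV[R]_n) (T : R)
    (a : 'rV[R]_n -> R) (v : 'rV[R]_n -> R -> R) : Prop :=
  forall x t, Omega x -> 0 < t < T ->
  [/\ forall i, derivable (v ^~ t) x 'e_i,
      forall i, derivable ('D_('e_i) (v ^~ t)) x 'e_i,
      derivable (v x) t 1 &
      'D_1 (v x) t = \sum_(i < n) 'D_('e_i) ('D_('e_i) (v ^~ t)) x +
        \sum_(i < n) ('D_('e_i) (v ^~ t) x) ^+ 2 + a x - expR (v x t)].

Lemma time_derive_interior (R : realType) (V : Type) (T : R) (f : V -> R -> R)
    (x : V) (t : R) :
  0 < t < T -> derivable (f x) t 1 -> time_derive `]0, T] f x t = 'D_1 (f x) t.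
Proof.
move=> /andP[t0 tT] fd.
(* Uniqueness of the limit needs points of []0, T]] other than [t] arbitrarily close to [t]; those
   on its left serve. *)
have pf : ProperFilter (within (`]0, T] `\ t) (nbhs t)).
  apply: within_nbhs_proper => B [d /= d0 dB].
  pose e := Num.min (d / 2) t / 2.
  have e0 : 0 < e by rewrite divr_gt0// lt_min t0 divr_gt0.
  have ed : e < d.
    have : Num.min (d / 2) t <= d / 2 by rewrite ge_min lexx.
    rewrite /e; lra.
  have et : e < t.
    have : Num.min (d / 2) t <= t by rewrite ge_min lexx orbT.
    rewrite /e; lra.
  exists (t - e); split; last by apply: dB; rewrite /= opprB addrCA subrr addr0 gtr0_norm.
  split=> /=; first by rewrite in_itv/=; apply/andP; split; lra.
  by move/eqP; rewrite -subr_eq0 addrAC subrr sub0r oppr_eq0 gt_eqF.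
apply: cvg_lim => //; apply/cvgrPdist_lt => e e0.
have /cvgrPdist_lt/(_ e e0) :
    h^-1 *: ((f x \o shift t) (h *: (1 : R)) - f x t) @[h --> (0 : R)^'] --> 'D_1 (f x) t.
  exact: fd.
move=> [d /= d0 Hd]; exists d => //= s st [_ /= sNt].
have := Hd (s - t); rewrite /= sub0r normrN distrC => /(_ st).
rewrite subr_eq0 => /(_ (introN eqP sNt)).
by rewrite /time_quotient [_ *: 1]mulr1 subrK [_ *: _]mulrC.
Qed.

Lemma ln_log_solution (R : realType) n (Omega : set 'rV[R]_n) (T : R)
    (a : 'rV[R]_n -> R) (u : 'rV[R]_n -> R -> R) :
  open Omega ->
  (forall t, 0 < t <= T -> Ck_closure 2 Omega (u ^~ t)) ->
  (forall x t, Omega x -> 0 < t < T -> derivable (u x) t 1) ->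
  (forall x t, Omega x -> 0 < t <= T -> 0 < u x t) ->
  (forall x t, Omega x -> 0 < t <= T ->
      time_derive `]0, T] u x t - laplacian (u ^~ t) x
        = a x * u x t - u x t ^+ 2) ->
  log_solution Omega T a (fun x t => ln (u x t)).
Proof.
move=> oO uC2 utd u0 ueq x t Ox t0T.
have t0T' : 0 < t <= T by case/andP: t0T => -> /ltW.
have [_ uC2t] := uC2 t t0T'.
have ud i y : Omega y -> is_derive y 'e_i (u ^~ t) ('D_('e_i) (u ^~ t) y).
  by move=> Oy; apply: derivableP; have [+ _] := uC2t 'e_i; exact.
have lnd i y : Omega y ->
    is_derive y 'e_i (fun y => ln (u y t)) ((u y t)^-1 * 'D_('e_i) (u ^~ t) y).
  move=> Oy; apply: is_derive_comp_real (ud i y Oy).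
  by apply: is_derive1_ln; exact: u0.
(* [Ck_closure] differentiates an extension [g] of the first derivative; [g] agrees with that
   derivative near [x], so the second derivative is transferred. *)
have udd i : is_derive x 'e_i ('D_('e_i) (u ^~ t)) ('D_('e_i) ('D_('e_i) (u ^~ t)) x).
  have [_ [g gu [_ Cg]]] := uC2t 'e_i; have [gd _] := Cg 'e_i.
  apply: derivableP; apply: near_eq_derivable (gd x Ox).
  by near=> y; apply: gu; near: y; exact: open_nbhs_nbhs.
have uinv i : is_derive x 'e_i (fun y => (u y t)^-1) (- (u x t) ^- 2 * 'D_('e_i) (u ^~ t) x).
  have ux : u x t != 0 by rewrite gt_eqF// u0.
  have [d1 _] := ud i x Ox.
  apply: DeriveDef; first exact: (derivableV ux d1).
  by rewrite (deriveV ux d1).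
have lndd i : is_derive x 'e_i ('D_('e_i) (fun y => ln (u y t)))
   ((u x t)^-1 * 'D_('e_i) ('D_('e_i) (u ^~ t)) x - (u x t) ^- 2 * ('D_('e_i) (u ^~ t) x) ^+ 2).
  have := is_deriveM (uinv i) (udd i).
  move=> /(is_derive_eq (df :=
    (u x t)^-1 * 'D_('e_i) ('D_('e_i) (u ^~ t)) x -
      (u x t) ^- 2 * ('D_('e_i) (u ^~ t) x) ^+ 2)) H.
  apply: near_eq_is_derive (H _).
    near=> y; have Oy : Omega y by near: y; exact: open_nbhs_nbhs.
    by rewrite (@derive_val _ _ _ _ _ _ _ (lnd i y Oy)).
  by rewrite /GRing.scale /=; ring.
have tld : is_derive t (1 : R) (fun t => ln (u x t)) ((u x t)^-1 * 'D_1 (u x) t).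
  apply: is_derive_comp_real; first by apply: is_derive1_ln; exact: u0.
  by apply: derivableP; exact: utd.
split=> [i|i||].
- by case: (lnd i x Ox).
- by case: (lndd i).
- by case: tld.
rewrite (@derive_val _ _ _ _ _ _ _ tld) lnK ?posrE ?u0//.
have := ueq x t Ox t0T'; rewrite time_derive_interior//; last exact: utd.
move/eqP; rewrite subr_eq => /eqP ->.
rewrite -big_split /= mulrDr mulrBr expr2 mulKf ?gt_eqF ?u0// mulrCA mulVf ?gt_eqF ?u0//.
rewrite mulr1 addrC -addrA; congr (_ + _).
rewrite /laplacian mulr_sumr; apply: eq_bigr => i _.
rewrite (@derive_val _ _ _ _ _ _ _ (lnd i x Ox)) (@derive_val _ _ _ _ _ _ _ (lndd i)).
by rewrite exprMn exprVn subrK.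
Unshelve. all: by end_near. Qed.

(** * Preservation of log-concavity *)

Lemma segment_pointDl (R : realType) (V : lmodType R) (x y e : V) (l s : R) :
  segment_point (x + s *: e) y l = segment_point x y l + (l * s) *: e.
Proof. by rewrite /segment_point scalerDr scalerA addrAC. Qed.

Lemma segment_pointDr (R : realType) (V : lmodType R) (x y e : V) (l s : R) :
  segment_point x (y + s *: e) l = segment_point x y l + ((1 - l) * s) *: e.
Proof. by rewrite /segment_point scalerDr scalerA addrA. Qed.

Lemma segment_pointD (R : realType) (V : lmodType R) (x y e : V) (l : R) :
  segment_point (x + e) (y + e) l = segment_point x y l + e.
Proof.
rewrite /segment_point !scalerDr addrACA -scalerDl addrCA subrr addr0.
by rewrite scale1r.
Qed.

Lemma expR_segment (R : realType) (l b c : R) : 0 <= l <= 1 ->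
  expR (l * b + (1 - l) * c) <= l * expR b + (1 - l) * expR c.
Proof.
move=> l01.
have := @convex_expR R (Itv01 (andP l01).1 (andP l01).2) b c.
by rewrite !convRE.
Qed.

(* At a negative minimum of [exp (- K t) (A - B)], where [A = u(z)] and
   [B = u(x)^l u(y)^(1-l)], the gradients satisfy [A r = B p = B q] and the sum
   of the second derivatives along [(e_i, e_i)] cancels the diffusion, leaving
   [(B - A) (K - abar + A + B) <= 0], where [abar] is the mean of [a x, a y]. *)
Lemma no_negative_minimum (R : realType) n (Omega : set 'rV[R]_n) (T : R)
    (a : 'rV[R]_n -> R) (v : 'rV[R]_n -> R -> R) (x y : 'rV[R]_n) (t l K : R) :
  open Omega -> log_solution Omega T a v ->
  Omega x -> Omega y -> Omega (segment_point x y l) -> 0 < t < T -> 0 < l < 1 ->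
  l * a x + (1 - l) * a y <= a (segment_point x y l) ->
  l * a x + (1 - l) * a y <= K ->
  let F x y t := expR (v (segment_point x y l) t)
                 - expR (l * v x t + (1 - l) * v y t) in
  F x y t < 0 ->
  (forall x' y', Omega x' -> Omega y' -> F x y t <= F x' y' t) ->
  (\forall s \near t^'-, expR (- K * t) * F x y t <= expR (- K * s) * F x y s) ->
  False.
Proof.
move=> oO sol Ox Oy Oz t0T /andP[l0 l1] az aK F Fneg Fsp Ft.
set z := segment_point x y l in Oz az F Fneg Fsp Ft *.
pose m := 1 - l.
have m0 : 0 < m by rewrite subr_gt0.
pose P i w := 'D_('e_i) (v ^~ t) w.
pose Q i w := 'D_('e_i) (P i) w.
have vd i w : Omega w -> is_derive w 'e_i (v ^~ t) (P i w).
  by move=> Ow; apply: derivableP; have [+ _ _ _] := sol w t Ow t0T; exact.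
have Pd i w : Omega w -> is_derive w 'e_i (P i) (Q i w).
  by move=> Ow; apply: derivableP; have [_ + _ _] := sol w t Ow t0T; exact.
pose D w := 'D_1 (v w) t.
have tdv w : Omega w -> is_derive t (1 : R) (v w) (D w).
  by move=> Ow; apply: derivableP; have [] := sol w t Ow t0T.
have vt w : Omega w -> D w = \sum_i Q i w + \sum_i (P i w) ^+ 2 + a w - expR (v w t).
  by move=> Ow; have [_ _ _ ] := sol w t Ow t0T.
clearbody D Q P.
have expd (f : R -> R) (s df : R) : is_derive s (1 : R) f df ->
    is_derive s (1 : R) (fun s => expR (f s)) (expR (f s) * df).
  by move=> fd; apply: is_derive_comp_real fd.
pose A := expR (v z t); pose B := expR (l * v x t + m * v y t).
have A0 : 0 < A by exact: expR_gt0.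
have B0 : 0 < B by exact: expR_gt0.
have AB : A < B by rewrite -subr_lt0.
have combd (f g : R -> R) (s df dg : R) : is_derive s (1 : R) f df -> is_derive s (1 : R) g dg ->
    is_derive s (1 : R) (fun s => l * f s + m * g s) (l * df + m * dg).
  by move=> fd gd; exact: (is_deriveD (is_deriveZ l fd) (is_deriveZ m gd)).
have lined i w s : Omega (w + s *: 'e_i) ->
    is_derive (s : R) (1 : R) (fun s => v (w + s *: 'e_i) t) (P i (w + s *: 'e_i)).
  by move=> Ow; apply: (is_derive_line (f := v ^~ t)); exact: vd.
have cstd (c s : R) : is_derive s (1 : R) (fun=> c) 0 by exact: is_derive_cst.
(* Moving [x] alone by [s] moves [z] by [l s], so the common factor [l] cancels from the
   stationarity condition. *)
have rp i : A * P i z = B * P i x.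
  have d1 : is_derive (0 : R) (1 : R) (fun s => F (x + s *: 'e_i) y t)
      (A * (l * P i z) - B * (l * P i x + m * 0)).
    have h1 : is_derive (0 : R) (1 : R) (fun s => v (z + (l * s) *: 'e_i) t) (l * P i z).
      by apply: (is_derive_line_scale (f := v ^~ t)); rewrite mulr0 scale0r addr0; exact: vd.
    have h2 : is_derive (0 : R) (1 : R) (fun s => l * v (x + s *: 'e_i) t + m * v y t)
        (l * P i x + m * 0).
      apply: combd => //; have := lined i x 0; rewrite scale0r addr0; exact.
    have := is_deriveB (expd _ _ _ h1) (expd _ _ _ h2).
    rewrite mulr0 !scale0r !addr0; congr is_derive.
    by apply/funext => s; rewrite /F segment_pointDl.
  have := local_min_derive_eq0 d1; rewrite mulr0 addr0 => H.
  have /H/eqP : \forall s \near (0 : R), F (x + (0 : R) *: 'e_i) y t <= F (x + s *: 'e_i) y t.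
    near=> s; rewrite scale0r addr0; apply: Fsp => //.
    by near: s; exact: near_line_open.
  rewrite mulrCA [B * _]mulrCA -mulrBr mulf_eq0 gt_eqF//= subr_eq0.
  by move/eqP.
have rq i : A * P i z = B * P i y.
  have d1 : is_derive (0 : R) (1 : R) (fun s => F x (y + s *: 'e_i) t)
      (A * (m * P i z) - B * (l * 0 + m * P i y)).
    have h1 : is_derive (0 : R) (1 : R) (fun s => v (z + (m * s) *: 'e_i) t) (m * P i z).
      by apply: (is_derive_line_scale (f := v ^~ t)); rewrite mulr0 scale0r addr0; exact: vd.
    have h2 : is_derive (0 : R) (1 : R) (fun s => l * v x t + m * v (y + s *: 'e_i) t)
        (l * 0 + m * P i y).
      apply: combd => //; have := lined i y 0; rewrite scale0r addr0; exact.
    have := is_deriveB (expd _ _ _ h1) (expd _ _ _ h2).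
    rewrite mulr0 !scale0r !addr0; congr is_derive.
    by apply/funext => s; rewrite /F segment_pointDr.
  have := local_min_derive_eq0 d1; rewrite mulr0 add0r => H.
  have /H/eqP : \forall s \near (0 : R), F x (y + (0 : R) *: 'e_i) t <= F x (y + s *: 'e_i) t.
    near=> s; rewrite scale0r addr0; apply: Fsp => //.
    by near: s; exact: near_line_open.
  rewrite mulrCA [B * _]mulrCA -mulrBr mulf_eq0 gt_eqF//= subr_eq0.
  by move/eqP.
have pq i : P i x = P i y.
  by apply: (mulfI (lt0r_neq0 B0)); rewrite -rp rq.
have sec i : B * (l * Q i x + m * Q i y + (P i x) ^+ 2) <= A * (Q i z + (P i z) ^+ 2).
  pose W s := l * v (x + s *: 'e_i) t + m * v (y + s *: 'e_i) t.
  pose W' s := l * P i (x + s *: 'e_i) + m * P i (y + s *: 'e_i).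
  pose f' s := expR (v (z + s *: 'e_i) t) * P i (z + s *: 'e_i) - expR (W s) * W' s.
  have Wd s : Omega (x + s *: 'e_i) -> Omega (y + s *: 'e_i) -> is_derive (s : R) (1 : R) W (W' s).
    by move=> Oxs Oys; apply: combd; exact: lined.
  have fE : (fun s => F (x + s *: 'e_i) (y + s *: 'e_i) t) =
            (fun s => expR (v (z + s *: 'e_i) t)) \- (fun s => expR (W s)).
    by apply/funext => s; rewrite /F segment_pointD.
  have W0 : W 0 = l * v x t + m * v y t by rewrite /W !scale0r !addr0.
  have W'0 : W' 0 = P i x.
    by rewrite /W' !scale0r !addr0 -pq -mulrDl /m addrCA subrr addr0 mul1r.
  have [||| _] := second_order_min (f := fun s => F (x + s *: 'e_i) (y + s *: 'e_i) t)
    (f' := f')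
    (L := A * (Q i z + (P i z) ^+ 2) - B * (l * Q i x + m * Q i y + (P i x) ^+ 2));
    last by rewrite subr_ge0.
  - near=> s; rewrite fE; apply: is_deriveB; apply: expd.
      by apply: lined; near: s; exact: near_line_open.
    by apply: Wd; near: s; exact: near_line_open.
  - have Pline w : Omega w -> is_derive (0 : R) (1 : R) (fun s => P i (w + s *: 'e_i)) (Q i w).
      by move=> Ow; apply: is_derive_line; rewrite scale0r addr0; exact: Pd.
    have lined0 w : Omega w -> is_derive (0 : R) (1 : R) (fun s => v (w + s *: 'e_i) t) (P i w).
      by move=> Ow; have := lined i w 0; rewrite scale0r addr0; exact.
    have muld (f g : R -> R) (df dg : R) : is_derive (0 : R) (1 : R) f df ->
        is_derive (0 : R) (1 : R) g dg ->
        is_derive (0 : R) (1 : R) (fun s => f s * g s) (f 0 * dg + g 0 * df).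
      by move=> fd gd; exact: (is_deriveM fd gd).
    have W0d : is_derive (0 : R) (1 : R) W (W' 0) by apply: Wd; rewrite scale0r addr0.
    have W'd : is_derive (0 : R) (1 : R) W' (l * Q i x + m * Q i y).
      exact: combd (Pline x Ox) (Pline y Oy).
    have h1 := muld _ _ _ _ (expd _ _ _ (lined0 z Oz)) (Pline z Oz).
    have h2 := muld _ _ _ _ (expd _ _ _ W0d) W'd.
    have h := is_deriveB h1 h2.
    suff E : A * (Q i z + P i z ^+ 2) - B * (l * Q i x + m * Q i y + P i x ^+ 2) =
      expR (v (z + (0 : R) *: 'e_i) t) * Q i z +
      P i (z + (0 : R) *: 'e_i) * (expR (v (z + (0 : R) *: 'e_i) t) * P i z) -
      (expR (W 0) * (l * Q i x + m * Q i y) + W' 0 * (expR (W 0) * W' 0)) by rewrite E.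
    rewrite W'0 W0 !scale0r !addr0 -/A -/B; ring.
  - near=> s; rewrite !scale0r !addr0; apply: Fsp; near: s; exact: near_line_open.
(* Only a left neighbourhood of [t] is available, whence an inequality. Differentiating the factor
   [exp (- K t)] contributes [(A - B) (- K)]. *)
have time : (A - B) * (- K) + A * D z - B * (l * D x + m * D y) <= 0.
  have h1 := is_deriveB (expd _ _ _ (tdv z Oz)) (expd _ _ _ (combd _ _ _ _ _ (tdv x Ox) (tdv y Oy))).
  have h2 : is_derive t (1 : R) (fun s => expR (- K * s)) (expR (- K * t) * (- K * 1)).
    by apply: expd; exact: (is_deriveZ (- K) (is_derive_id _ _)).
  have := left_min_derive_le0 (is_deriveM h2 h1) Ft.
  rewrite /GRing.scale /= -/A -/B -/m.
  set D' := _ + m * _.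
  have -> : expR (- K * t) * (A * D z - B * D') + (A - B) * (expR (- K * t) * (- K * 1)) =
     expR (- K * t) * ((A - B) * - K + A * D z - B * D') by ring.
  by rewrite pmulr_rle0// expR_gt0.
have S : B * (l * (\sum_i Q i x) + m * (\sum_i Q i y) + \sum_i (P i x) ^+ 2)
     <= A * (\sum_i Q i z + \sum_i (P i z) ^+ 2).
  rewrite [_ * \sum_i Q i x]mulr_sumr [_ * \sum_i Q i y]mulr_sumr -!big_split /= !mulr_sumr.
  by apply: ler_sum => i _; exact: sec.
have Pxy : \sum_i (P i y) ^+ 2 = \sum_i (P i x) ^+ 2 by apply: eq_bigr => i _; rewrite pq.
(* Weighted arithmetic-geometric mean inequality. It bounds the mean of the values of [u] below by
   [B], which gives the term [- u^2] of the equation a favourable sign. *)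
have Bu : B <= l * expR (v x t) + m * expR (v y t) by apply: expR_segment; rewrite (ltW l0) ltW.
have lm : l + m = 1 by rewrite /m addrCA subrr addr0.
move: time; rewrite !vt// Pxy -/A.
set az' := a z in az *; set Sz := \sum_i Q i z + _ in S *.
set qx := \sum_i Q i x in S *; set qy := \sum_i Q i y in S *.
set px := \sum_i (P i x) ^+ 2 in S *.
set ux := expR (v x t) in Bu *; set uy := expR (v y t) in Bu *.
rewrite -/m in az aK.
set ab := l * a x + m * a y in az aK *.
have -> : B * (l * (qx + px + a x - ux) + m * (qy + px + a y - uy)) =
  B * (l * qx + m * qy + (l + m) * px) + B * ab - B * (l * ux + m * uy).
  by rewrite /ab; ring.
rewrite lm mul1r => time.
have h1 : A * ab <= A * az' by rewrite ler_pM2l.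
have h2 : B * B <= B * (l * ux + m * uy) by rewrite ler_pM2l.
have h3 : 0 < (B - A) * (K - ab + A + B).
  by rewrite mulr_gt0 ?subr_gt0// -addrA ltr_wpDl ?subr_ge0// addr_gt0.
nra.
Unshelve. all: by end_near. Qed.

(** * Continuity of the two-point function *)

Lemma within_continuous_comp (S T U : topologicalType) (A : set S) (B : set T)
    (g : S -> T) (f : T -> U) :
  continuous g -> (forall x, A x -> B (g x)) -> {within B, continuous f} ->
  {within A, continuous (fun x => f (g x))}.
Proof.
move=> cg AB /subspace_continuousP cf; apply/subspace_continuousP => x Ax.
apply: cvg_comp (cf _ (AB _ Ax)) => P BP.
have : nbhs x (g @^-1` [set y | B y -> P y]) by exact: cg.
by apply: filterS => y /= + Ay; apply; exact: AB.
Qed.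

(** The geometric mean has to be continuous up to the boundary, where [u] vanishes. The absolute
    value makes the power continuous on the whole line, so that it can be composed without sign
    conditions; the point 0 is separate because powers are defined there by a case distinction. *)
Lemma continuous_norm_powR (R : realType) (p : R) : 0 < p ->
  continuous (fun r : R => `|r| `^ p).
Proof.
move=> p0 r; rewrite /continuous_at; have [->|r0] := eqVneq r 0.
  rewrite normr0 powR0 ?gt_eqF//; apply/cvgrPdist_lt => e e0.
  have d0 : 0 < e `^ p^-1 by exact: powR_gt0.
  near=> h.
  have hd : `|h| < e `^ p^-1 by near: h; exact: (@nbhs0_lt R R).
  rewrite sub0r normrN ger0_norm ?powR_ge0//.
  have -> : e = (e `^ p^-1) `^ p by rewrite -powRrM mulVf ?gt_eqF// powRr1// ltW.
  by apply: gt0_ltr_powR; rewrite ?nnegrE ?powR_ge0.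
rewrite {2}/powR normr_eq0 (negbTE r0).
have c : expR (p * ln `|s|) @[s --> r] --> expR (p * ln `|r|).
  apply: continuous_cvg; first exact: continuous_expR.
  apply: cvgM; first exact: cvg_cst.
  apply: continuous_cvg; first by apply: continuous_ln; rewrite normr_gt0.
  by apply: cvg_norm; exact: cvg_id.
apply: cvg_trans c; apply: near_eq_cvg; near=> s.
rewrite /powR normr_eq0 ifF//; apply/negbTE; near: s.
exact: (open_neq r0).
Unshelve. all: by end_near. Qed.

Lemma segment_pointC (R : realType) (V : lmodType R) (x y : V) (l : R) :
  segment_point x y l = segment_point y x (1 - l).
Proof. by rewrite /segment_point opprB addrCA subrr addr0 addrC. Qed.

Lemma closure_segment (R : realType) (V : normedModType R) (A : set V) (x y : V) (l : R) :
  (forall x y, A x -> A y -> A (segment_point x y l)) ->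
  closure A x -> closure A y -> closure A (segment_point x y l).
Proof.
move=> cA cx cy.
have step z w k : (forall w', A w' -> closure A (segment_point z w' k)) ->
    closure A w -> closure A (segment_point z w k).
  move=> H cw; apply: (@closed_closure _ A) => B nB.
  have [w' [Aw' Bw']] := cw _ (@segment_point_continuousr R V z k w _ nB).
  by exists (segment_point z w' k); split=> //; exact: H.
apply: (step _ _ _ _ cy) => y' Ay'.
rewrite segment_pointC; apply: (step _ _ _ _ cx) => x' Ax'.
by rewrite -segment_pointC; apply: subset_closure; exact: cA.
Qed.

Lemma continuous_pair (S T U : topologicalType) (f : S -> T) (g : S -> U) :
  continuous f -> continuous g -> continuous (fun x => (f x, g x)).
Proof. by move=> cf cg x; apply: cvg_pair; [exact: cf|exact: cg]. Qed.

Lemma continuous_fst_fst (S T U : topologicalType) :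
  continuous (fun w : S * T * U => w.1.1).
Proof. by move=> w; apply: (cvg_comp fst fst); exact: cvg_fst. Qed.

Lemma continuous_fst_snd (S T U : topologicalType) :
  continuous (fun w : S * T * U => w.1.2).
Proof. by move=> w; apply: (cvg_comp fst snd); [exact: cvg_fst|exact: cvg_snd]. Qed.

Lemma continuous_linear2 (R : realType) (T : topologicalType) (V : normedModType R)
    (f g : T -> V) (b c : R) :
  continuous f -> continuous g -> continuous (fun w => b *: f w + c *: g w).
Proof.
by move=> cf cg x; apply: cvgD; apply: cvgZl_tmp; [exact: cf|exact: cg].
Qed.

Lemma log_concave_preserved (R : realType) n (Omega : set 'rV[R]_n) (T K : R)
    (a : 'rV[R]_n -> R) (u : 'rV[R]_n -> R -> R) :
  open Omega ->
  (forall x y l, Omega x -> Omega y -> 0 <= l <= 1 -> Omega (segment_point x y l)) ->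
  compact (closure Omega) ->
  {within closure Omega `*` `[0, T], continuous (fun z => u z.1 z.2)} ->
  log_solution Omega T a (fun x t => ln (u x t)) ->
  (forall x t, Omega x -> 0 <= t <= T -> 0 < u x t) ->
  (forall x t, boundary Omega x -> 0 <= t <= T -> u x t = 0) ->
  (forall x y l, Omega x -> Omega y -> 0 < l < 1 ->
    l * ln (u x 0) + (1 - l) * ln (u y 0) <= ln (u (segment_point x y l) 0)) ->
  (forall x y l, Omega x -> Omega y -> 0 < l < 1 ->
    l * a x + (1 - l) * a y <= a (segment_point x y l)) ->
  (forall x, Omega x -> a x <= K) ->
  forall x y t l, Omega x -> Omega y -> 0 < t < T -> 0 < l < 1 ->
    l * ln (u x t) + (1 - l) * ln (u y t) <= ln (u (segment_point x y l) t).
Proof.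
move=> oO cvx cpt cu sol up ub ini ac aK x0 y0 t0 l Ox0 Oy0 t0T l01.
have [l0 l1] : 0 < l /\ 0 < 1 - l by case/andP: l01; rewrite subr_gt0.
have l01' : 0 <= l <= 1 by case/andP: l01 => /ltW -> /ltW ->.
have [t00 t0T'] := andP t0T.
rewrite leNgt; apply/negP => neg.
pose F x y t := expR (ln (u (segment_point x y l) t))
                 - expR (l * ln (u x t) + (1 - l) * ln (u y t)).
(* [F] involves logarithms and is meaningful in Omega only; [G] is its weighted version, extended to
   the closure. *)
pose G (w : 'rV[R]_n * 'rV[R]_n * R) := expR (- K * w.2) *
  (u (segment_point w.1.1 w.1.2 l) w.2 - `|u w.1.1 w.2| `^ l * `|u w.1.2 w.2| `^ (1 - l)).
have GF x y t : Omega x -> Omega y -> 0 <= t <= T -> G (x, y, t) = expR (- K * t) * F x y t.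
  move=> Ox Oy t0T1; rewrite /G /F /=; congr (_ * (_ - _)).
    by rewrite lnK// posrE up//; exact: cvx.
  by rewrite /powR !normr_eq0 !gt_eqF ?up// !gtr0_norm ?up// -expRD.
(* Stopping at [t0 < T] ensures that the equation, with a two-sided time derivative, holds at the
   time of the minimum. *)
pose D := (closure Omega `*` closure Omega) `*` `[0, t0].
have cD : compact D by apply: compact_setX; [exact: compact_setX|exact: segment_compact].
have clO x y : closure Omega x -> closure Omega y -> closure Omega (segment_point x y l).
  by apply: closure_segment => x' y' Ox Oy; exact: cvx.
have cG : {within D, continuous G}.
  have ucomp (g : 'rV[R]_n * 'rV[R]_n * R -> 'rV[R]_n * R) : continuous g ->
      (forall w, D w -> (closure Omega `*` `[0, T]) (g w)) ->
      {within D, continuous (fun w => u (g w).1 (g w).2)}.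
    by move=> cg gD; exact: (within_continuous_comp cg gD cu).
  have c1 : {within D, continuous (fun w => u (segment_point w.1.1 w.1.2 l) w.2)}.
    apply: (ucomp (fun w => (segment_point w.1.1 w.1.2 l, w.2))).
      apply: continuous_pair; last by move=> w; exact: cvg_snd.
      by apply: continuous_linear2; [exact: continuous_fst_fst|exact: continuous_fst_snd].
    move=> [[x y] t] [[/= cx cy]]; rewrite in_itv/= => /andP[t1 t2].
    split=> /=; first exact: clO.
    by rewrite in_itv/= t1 (le_trans t2)// ltW.
  have c2 : {within D, continuous (fun w => `|u w.1.1 w.2| `^ l)}.
    move=> w; apply: (@continuous_comp _ _ _ _ (fun r : R => `|r| `^ l));
      last exact: continuous_norm_powR.
    move: w; apply: (ucomp (fun w => (w.1.1, w.2))).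
      apply: continuous_pair; last by move=> w; exact: cvg_snd.
      exact: continuous_fst_fst.
    move=> [[x y] t] [[/= cx cy]]; rewrite in_itv/= => /andP[t1 t2].
    by split=> //=; rewrite in_itv/= t1 (le_trans t2)// ltW.
  have c3 : {within D, continuous (fun w => `|u w.1.2 w.2| `^ (1 - l))}.
    move=> w; apply: (@continuous_comp _ _ _ _ (fun r : R => `|r| `^ (1 - l)));
      last exact: continuous_norm_powR.
    move: w; apply: (ucomp (fun w => (w.1.2, w.2))).
      apply: continuous_pair; last by move=> w; exact: cvg_snd.
      exact: continuous_fst_snd.
    move=> [[x y] t] [[/= cx cy]]; rewrite in_itv/= => /andP[t1 t2].
    by split=> //=; rewrite in_itv/= t1 (le_trans t2)// ltW.
  have c4 : {within D, continuous (fun w => expR (- K * w.2))}.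
    apply: continuous_subspaceT => w; apply: continuous_cvg; first exact: continuous_expR.
    by apply: cvgM; [exact: cvg_cst|exact: cvg_snd].
  move=> w; apply: cvgM; first exact: c4.
  by apply: cvgB; [exact: c1|apply: cvgM; [exact: c2|exact: c3]].
have D0 : D (x0, y0, t0).
  by split; [split; exact: subset_closure|rewrite /= in_itv/= lexx ltW].
have [[[x y] t] /set_mem[[/= cx cy] /=]] := compact_EVT_min (ex_intro _ _ D0) cD cG.
rewrite in_itv/= => /andP[tge0 tt0] Gmin.
have tT : t < T by exact: le_lt_trans t0T'.
have t0T1 : 0 <= t <= T by rewrite tge0 ltW.
have Gneg : G (x, y, t) < 0.
  apply: (le_lt_trans (Gmin _ (mem_set D0))); rewrite GF//; last by rewrite !ltW.
  by rewrite pmulr_rlt0 ?expR_gt0// subr_lt0 ltr_expR.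
have uz0 : 0 <= u (segment_point x y l) t.
  have [Oz|nz] := pselect (Omega (segment_point x y l)); first by rewrite ltW// up.
  rewrite ub//; split; first exact: clO.
  by rewrite /= (interior_id _).1.
have Ox : Omega x.
  apply: contrapT => nx; move: Gneg; rewrite /G /= [u x t]ub//; last first.
    by split=> //=; rewrite (interior_id _).1.
  rewrite normr0 (powR0 (lt0r_neq0 l0)) mul0r subr0 ltNge.
  by rewrite mulr_ge0 ?expR_ge0.
have Oy : Omega y.
  apply: contrapT => nx; move: Gneg; rewrite /G /= [u y t]ub//; last first.
    by split=> //=; rewrite (interior_id _).1.
  rewrite normr0 (powR0 (lt0r_neq0 l1)) mulr0 subr0 ltNge.
  by rewrite mulr_ge0 ?expR_ge0.
have Fneg : F x y t < 0 by move: Gneg; rewrite GF// pmulr_rlt0 ?expR_gt0.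
have tgt0 : 0 < t.
  rewrite lt_neqAle tge0 andbT eq_sym; apply/eqP => t_0.
  by move: Fneg; rewrite /F t_0 subr_lt0 ltr_expR ltNge ini.
apply: (@no_negative_minimum R n Omega T a (fun x t => ln (u x t)) x y t l K oO sol Ox Oy) => //.
- exact: cvx.
- by rewrite tgt0.
- exact: ac.
- have -> : K = l * K + (1 - l) * K by rewrite -mulrDl addrCA subrr addr0 mul1r.
  by rewrite lerD// ler_pM2l ?aK.
- move=> x' y' Ox' Oy'.
  have Dw : D (x', y', t).
    by split; [split; exact: subset_closure|rewrite /= in_itv/= tge0].
  by have := Gmin _ (mem_set Dw); rewrite !GF// ler_pM2l ?expR_gt0.
- near=> s.
  have s0 : 0 < s by near: s; exact: nbhs_left_gt.
  have st : s < t by near: s; exact: nbhs_left_lt.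
  have Dw : D (x, y, s).
    by split=> //=; rewrite in_itv/= ltW//= (le_trans _ tt0)// ltW.
  by have := Gmin _ (mem_set Dw); rewrite !GF// ltW//= (le_trans (ltW st))// ltW.
Unshelve. all: by end_near. Qed.

(** * Strict concavity: the moving barrier *)

Lemma dot_shift (R : realType) n (x w : 'rV[R]_n) (s : R) :
  dot (x + s *: w) (x + s *: w) = dot x x + 2 * s * dot x w + s ^+ 2 * dot w w.
Proof.
rewrite !dotE !mulr_sumr -!big_split; apply: eq_bigr => i _ /=.
rewrite !mxE; ring.
Qed.

Lemma dot_delta (R : realType) n (x : 'rV[R]_n) (i : 'I_n) :
  dot x 'e_i = x ord0 i.
Proof.
rewrite dotE (bigD1 i)//= !mxE !eqxx mulr1 big1 ?addr0// => j ji.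
by rewrite !mxE (negbTE ji) andbF mulr0.
Qed.

Lemma is_derive_dot_shift (R : realType) n (x w : 'rV[R]_n) (s : R) :
  is_derive s (1 : R) (fun s : R => dot (x + s *: w) (x + s *: w))
    (2 * dot (x + s *: w) w).
Proof.
have -> : (fun s : R => dot (x + s *: w) (x + s *: w)) =
    (fun s : R => dot x x) + ((2 * dot x w) *: id + dot w w *: (id * id)).
  apply/funext => r; rewrite dot_shift -addrA; congr (_ + _).
  rewrite -[RHS]/((2 * dot x w) * r + dot w w * (r * r)); ring.
have := is_deriveD (is_derive_cst (dot x x) s (1 : R))
  (is_deriveD (is_deriveZ (2 * dot x w) (is_derive_id s (1 : R)))
     (is_deriveZ (dot w w) (is_deriveM (is_derive_id s (1 : R)) (is_derive_id s (1 : R))))).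
have -> : dot (x + s *: w) w = dot x w + s * dot w w.
  rewrite !dotE mulr_sumr -big_split; apply: eq_bigr => i _ /=.
  rewrite !mxE; ring.
congr is_derive; rewrite /GRing.scale /=; ring.
Qed.

(** At a point with [G < 0] and [C >= 0], both [C] and [N |d - d0|^2] are at most [phi]. Hence every
    error in the equation for the defect is either of order zero in [phi] or linear in its gradient.
    The conclusion is the inequality that a strict subsolution [phi] violates. *)
Lemma barrier_inequality (R : realType) n (Omega : set 'rV[R]_n) (T : R)
    (a : 'rV[R]_n -> R) (v phi : 'rV[R]_n -> R -> R)
    (phi1 : 'I_n -> 'rV[R]_n -> R) (phi2 : 'I_n -> R) (phit : R)
    (m d d0 : 'rV[R]_n) (t l N B U : R) :
  let X d m := m + (1 - l) *: d in
  let Y d m := m - l *: d in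
  let C m d t := v m t - (l * v (X d m) t + (1 - l) * v (Y d m) t) in
  let G m d t := C m d t - phi m t + N * dot (d - d0) (d - d0) in
  open Omega -> log_solution Omega T a v ->
  Omega m -> Omega (X d m) -> Omega (Y d m) -> 0 < t < T -> 0 < l < 1 ->
  l * a (X d m) + (1 - l) * a (Y d m) <= a m ->
  (forall i m, is_derive m 'e_i (phi ^~ t) (phi1 i m)) ->
  (forall i, is_derive m 'e_i (phi1 i) (phi2 i)) ->
  is_derive t (1 : R) (phi m) phit ->
  0 <= N -> 0 <= C m d t -> G m d t < 0 ->
  (forall i, `|'D_('e_i) (v ^~ t) (X d m)| <= B) ->
  (forall i, `|'D_('e_i) (v ^~ t) (Y d m)| <= B) ->
  expR (v m t) <= U ->
  (forall i, \forall s \near (0 : R), G m d t <= G (m + s *: 'e_i) d t) ->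
  (forall i, \forall s \near (0 : R), G m d t <= G m (d + s *: 'e_i) t) ->
  (\forall s \near t^'-, G m d t <= G m d s) ->
  \sum_i phi2 i - 2 * B * \sum_i `|phi1 i m|
    - (4 * N / (l * (1 - l)) + U) * phi m t <= phit.
Proof.
move=> X Y C G oO sol Om OX OY t0T l01 aC phid phidd phidt N0 C0 G0 BX BY mU Gm Gd Gt.
pose k := 1 - l.
have [l0 k0] : 0 < l /\ 0 < k by case/andP: l01; rewrite subr_gt0.
have lk : l + k = 1 by rewrite /k addrCA subrr addr0.
pose P i w := 'D_('e_i) (v ^~ t) w.
pose Q i w := 'D_('e_i) (P i) w.
have vd i w : Omega w -> is_derive w 'e_i (v ^~ t) (P i w).
  by move=> Ow; apply: derivableP; have [+ _ _ _] := sol w t Ow t0T; exact.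
have Pd i w : Omega w -> is_derive w 'e_i (P i) (Q i w).
  by move=> Ow; apply: derivableP; have [_ + _ _] := sol w t Ow t0T; exact.
pose D w := 'D_1 (v w) t.
have tdv w : Omega w -> is_derive t (1 : R) (v w) (D w).
  by move=> Ow; apply: derivableP; have [] := sol w t Ow t0T.
have vt w : Omega w -> D w = \sum_i Q i w + \sum_i (P i w) ^+ 2 + a w - expR (v w t).
  by move=> Ow; have [_ _ _ ] := sol w t Ow t0T.
have {}BX i : `|P i (X d m)| <= B by exact: BX.
have {}BY i : `|P i (Y d m)| <= B by exact: BY.
clearbody D Q P.
have combd (f g : R -> R) (s df dg : R) : is_derive s (1 : R) f df -> is_derive s (1 : R) g dg ->
    is_derive s (1 : R) (fun s => l * f s + k * g s) (l * df + k * dg).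
  by move=> fd gd; exact: (is_deriveD (is_deriveZ l fd) (is_deriveZ k gd)).
have lined i w s : Omega (w + s *: 'e_i) ->
    is_derive (s : R) (1 : R) (fun s => v (w + s *: 'e_i) t) (P i (w + s *: 'e_i)).
  by move=> Ow; apply: (is_derive_line (f := v ^~ t)); exact: vd.
have XD m' d' e : X d' (m' + e) = X d' m' + e by rewrite /X addrAC.
have YD m' d' e : Y d' (m' + e) = Y d' m' + e by rewrite /Y addrAC.
(* Translating [m] with [d] fixed translates the three points together and leaves the penalty
   constant, so the first and second order conditions are both usable. *)
have spatial i : P i m - (l * P i (X d m) + k * P i (Y d m)) - phi1 i m = 0 /\
    0 <= Q i m - (l * Q i (X d m) + k * Q i (Y d m)) - phi2 i.
  pose f' s := P i (m + s *: 'e_i) - (l * P i (X d m + s *: 'e_i) + k * P i (Y d m + s *: 'e_i))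
               - phi1 i (m + s *: 'e_i).
  have fE : (fun s => G (m + s *: 'e_i) d t) =
      (fun s => v (m + s *: 'e_i) t)
        \- (fun s => l * v (X d m + s *: 'e_i) t + k * v (Y d m + s *: 'e_i) t)
        \- (fun s => phi (m + s *: 'e_i) t) \+ (fun=> N * dot (d - d0) (d - d0)).
    by apply/funext => s; rewrite /G /C XD YD.
  have [|||H1 H2] := second_order_min (f := fun s => G (m + s *: 'e_i) d t) (f' := f')
      (L := Q i m - (l * Q i (X d m) + k * Q i (Y d m)) - phi2 i).
  - near=> s; rewrite fE.
    have h1 : is_derive (s : R) (1 : R) (fun s => v (m + s *: 'e_i) t) (P i (m + s *: 'e_i)).
      by apply: lined; near: s; exact: near_line_open.
    have h2 : is_derive (s : R) (1 : R) (fun s => v (X d m + s *: 'e_i) t) (P i (X d m + s *: 'e_i)).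
      by apply: lined; near: s; exact: near_line_open.
    have h3 : is_derive (s : R) (1 : R) (fun s => v (Y d m + s *: 'e_i) t) (P i (Y d m + s *: 'e_i)).
      by apply: lined; near: s; exact: near_line_open.
    have h4 : is_derive (s : R) (1 : R) (fun s => phi (m + s *: 'e_i) t) (phi1 i (m + s *: 'e_i)).
      by apply: (is_derive_line (f := phi ^~ t)); exact: phid.
    have := is_deriveD (is_deriveB (is_deriveB h1 (combd _ _ _ _ _ h2 h3)) h4)
       (is_derive_cst (N * dot (d - d0) (d - d0)) (s : R) (1 : R)).
    by rewrite addr0.
  - have Pline w : Omega w -> is_derive (0 : R) (1 : R) (fun s => P i (w + s *: 'e_i)) (Q i w).
      by move=> Ow; apply: is_derive_line; rewrite scale0r addr0; exact: Pd.
    have h4 : is_derive (0 : R) (1 : R) (fun s => phi1 i (m + s *: 'e_i)) (phi2 i).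
      by apply: is_derive_line; rewrite scale0r addr0; exact: phidd.
    exact: (is_deriveB (is_deriveB (Pline m Om) (combd _ _ _ _ _ (Pline _ OX) (Pline _ OY))) h4).
  - by apply: filterS (Gm i) => s; rewrite scale0r addr0.
  by split=> //; rewrite -[RHS]H1 /f' !scale0r !addr0.
(* Changing [d] alone leaves [m] and the barrier fixed; only the first order condition is needed. *)
have dd i : l * k * (P i (X d m) - P i (Y d m)) = 2 * N * (d - d0) ord0 i.
  have fE : (fun s => G m (d + s *: 'e_i) t) =
      (fun=> v m t)
        \- (fun s => l * v (X d m + (k * s) *: 'e_i) t + k * v (Y d m + (- l * s) *: 'e_i) t)
        \- (fun=> phi m t) \+
      N *: (fun s => dot ((d - d0) + s *: 'e_i) ((d - d0) + s *: 'e_i)).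
    apply/funext => s; rewrite /G /C.
    have -> : X (d + s *: 'e_i) m = X d m + (k * s) *: 'e_i.
      by rewrite /X scalerDr scalerA addrA.
    have -> : Y (d + s *: 'e_i) m = Y d m + (- l * s) *: 'e_i.
      by rewrite /Y scalerDr scalerA opprD addrA mulNr scaleNr.
    by rewrite [d + _ - d0]addrAC.
  have h2 : is_derive (0 : R) (1 : R) (fun s => v (X d m + (k * s) *: 'e_i) t) (k * P i (X d m)).
    by apply: (is_derive_line_scale (f := v ^~ t)); rewrite mulr0 scale0r addr0; exact: vd.
  have h3 : is_derive (0 : R) (1 : R) (fun s => v (Y d m + (- l * s) *: 'e_i) t) (- l * P i (Y d m)).
    by apply: (is_derive_line_scale (f := v ^~ t)); rewrite mulr0 scale0r addr0; exact: vd.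
  have h5 := is_derive_dot_shift (d - d0) 'e_i (0 : R); rewrite scale0r addr0 dot_delta in h5.
  have : is_derive (0 : R) (1 : R) (fun s => G m (d + s *: 'e_i) t)
      (0 - (l * (k * P i (X d m)) + k * (- l * P i (Y d m))) - 0 + N *: (2 * (d - d0) ord0 i)).
    rewrite fE; exact: (is_deriveD
      (is_deriveB (is_deriveB (is_derive_cst (v m t) (0 : R) (1 : R)) (combd _ _ _ _ _ h2 h3))
     (is_derive_cst (phi m t) (0 : R) (1 : R))) (is_deriveZ N h5)).
  move=> /local_min_derive_eq0 H.
  have /H : \forall s \near (0 : R), G m (d + (0 : R) *: 'e_i) t <= G m (d + s *: 'e_i) t.
    by apply: filterS (Gd i) => s; rewrite scale0r addr0.
  rewrite /GRing.scale /=; lra.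
have time : D m - (l * D (X d m) + k * D (Y d m)) - phit <= 0.
  have := is_deriveD (is_deriveB (is_deriveB (tdv _ Om) (combd _ _ _ _ _ (tdv _ OX) (tdv _ OY))) phidt)
    (is_derive_cst (N * dot (d - d0) (d - d0)) t (1 : R)).
  by rewrite addr0 => /left_min_derive_le0; apply; exact: Gt.
have Cphi : C m d t <= phi m t.
  move: G0; rewrite /G; have : 0 <= N * dot (d - d0) (d - d0).
    by rewrite mulr_ge0// dot_ge0.
  lra.
have Nphi : N * dot (d - d0) (d - d0) <= phi m t by move: G0; rewrite /G; lra.
have phi0 : 0 <= phi m t by exact: le_trans Cphi.
(* The mean of [v] at the end points is [v(m) - C]; then [exp (- C) >= 1 - C], [C <= phi] and
   [exp v(m) <= U]. *)
have expC : expR (v m t) - U * phi m t <=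
    l * expR (v (X d m) t) + k * expR (v (Y d m) t).
  have : expR (l * v (X d m) t + k * v (Y d m) t) <= l * expR (v (X d m) t) + k * expR (v (Y d m) t).
    by apply: expR_segment; case/andP: l01 => /ltW -> /ltW ->.
  apply: le_trans.
  have -> : l * v (X d m) t + k * v (Y d m) t = v m t + (- C m d t).
    by rewrite /C opprB addrCA subrr addr0.
  rewrite expRD.
  have e1 := expR_ge1Dx (- C m d t).
  have e0 := expR_gt0 (v m t).
  apply: (@le_trans _ _ (expR (v m t) * (1 - C m d t))); last by rewrite ler_pM2l.
  rewrite mulrBr mulr1 lerD2l lerN2.
  by apply: ler_pM => //; exact: ltW.
(* Substituting stationarity in [m] turns the defect of squares into
   [e^2 + 2 e (l p + k q) - l k (p - q)^2]. The last term is computed from stationarity in [d], and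
   [B] bounds the mean [l p + k q]. *)
have grad_i i : - (2 * B * `|phi1 i m|) - 4 * N ^+ 2 / (l * k) * ((d - d0) ord0 i) ^+ 2
    <= (P i m) ^+ 2 - (l * (P i (X d m)) ^+ 2 + k * (P i (Y d m)) ^+ 2).
  have [/eqP + _] := spatial i; rewrite subr_eq0 subr_eq => /eqP ->.
  have := dd i; set p := P i (X d m); set q := P i (Y d m); set e := phi1 i m.
  set w := _ ord0 i => ddi.
  have lk0 : 0 < l * k by exact: mulr_gt0.
  have E : 4 * N ^+ 2 / (l * k) * w ^+ 2 = l * k * (p - q) ^+ 2.
    have -> : 4 * N ^+ 2 / (l * k) * w ^+ 2 = (2 * N * w) ^+ 2 / (l * k).
      by rewrite -!mulrA [_^-1 * _]mulrC; ring.
    rewrite -ddi exprMn expr2 -!mulrA [_ / _]mulrC.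
    by field; rewrite !gt_eqF.
  rewrite E.
  have -> : (e + (l * p + k * q)) ^+ 2 - (l * p ^+ 2 + k * q ^+ 2) =
     e ^+ 2 + 2 * e * (l * p + k * q) - l * k * (p - q) ^+ 2.
    by have -> : k = 1 - l by []; ring.
  rewrite lerD2r.
  have b : `|l * p + k * q| <= B.
    rewrite (le_trans (ler_normD _ _))// !normrM (gtr0_norm l0) (gtr0_norm k0).
    have -> : B = l * B + k * B by rewrite -mulrDl lk mul1r.
    by rewrite lerD// ler_pM2l// ?BX ?BY.
  have : - (`|e| * B) <= e * (l * p + k * q).
    rewrite lerNl -mulrN (le_trans (ler_norm _))// normrM normrN.
    by rewrite ler_wpM2l.
  have := sqr_ge0 e; lra.
have gradS : - (2 * B * \sum_i `|phi1 i m|) - 4 * N ^+ 2 / (l * k) * dot (d - d0) (d - d0)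
    <= \sum_i (P i m) ^+ 2 - (l * \sum_i (P i (X d m)) ^+ 2 + k * \sum_i (P i (Y d m)) ^+ 2).
  rewrite dotE !mulr_sumr -big_split -!sumrB -sumrN -sumrB /=.
  by apply: ler_sum => i _; rewrite -expr2; exact: grad_i.
have lapS : \sum_i phi2 i <= \sum_i Q i m - (l * \sum_i Q i (X d m) + k * \sum_i Q i (Y d m)).
  rewrite !mulr_sumr -big_split -sumrB /=; apply: ler_sum => i _.
  by have [_] := spatial i; rewrite subr_ge0.
have Ndot : 4 * N ^+ 2 / (l * k) * dot (d - d0) (d - d0) <= 4 * N / (l * k) * phi m t.
  have -> : 4 * N ^+ 2 / (l * k) * dot (d - d0) (d - d0) =
    4 * N / (l * k) * (N * dot (d - d0) (d - d0)) by ring.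
  by rewrite ler_wpM2l// divr_ge0 ?mulr_ge0// ltW.
move: time; rewrite !vt//.
rewrite -/k in aC.
have -> : (4 * N / (l * (1 - l)) + U) * phi m t = 4 * N / (l * k) * phi m t + U * phi m t.
  by rewrite mulrDl.
lra.
Unshelve. all: by end_near. Qed.

Lemma is_derive_congr (R : realType) (V W : normedModType R) (f g : V -> W)
    (x v : V) (df dg : W) :
  is_derive x v f df -> f =1 g -> df = dg -> is_derive x v g dg.
Proof. by move=> h /funext <- <-. Qed.

(* Completing the square, [16 r^2] times the left-hand side below is
   [(A s - 8 r^2)^2 + s^2 + 64 r^4]. *)
Lemma barrier_discriminant (R : realType) (r A s : R) : 0 < r ->
  0 < (A ^+ 2 + 1) / (16 * r ^+ 2) * s ^+ 2 - A * s + 8 * r ^+ 2.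
Proof.
move=> r0; have r20 : 0 < 16 * r ^+ 2 by rewrite mulr_gt0// exprn_gt0.
rewrite -(pmulr_rgt0 _ r20).
have -> : 16 * r ^+ 2 * ((A ^+ 2 + 1) / (16 * r ^+ 2) * s ^+ 2 - A * s + 8 * r ^+ 2)
  = (A * s - 8 * r ^+ 2) ^+ 2 + s ^+ 2 + 64 * r ^+ 4.
  by field; rewrite gt_eqF.
by rewrite ltr_wpDl ?addr_ge0 ?sqr_ge0// mulr_gt0// exprn_gt0.
Qed.

Lemma coord_le_dot (R : realType) n (x : 'rV[R]_n) (r : R) i :
  0 <= r -> dot x x <= r ^+ 2 -> `|x ord0 i| <= r.
Proof.
move=> r0 xr; rewrite -(ler_pXn2r (_ : 0 < 2)%N) ?nnegrE// real_normK ?num_real//.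
apply: le_trans xr; rewrite dotE (bigD1 i)//= -expr2 lerDl sumr_ge0// => j _.
by rewrite -expr2 sqr_ge0.
Qed.

(** The vector [w] is minus the velocity: the centre arrives at [z0] at the final time [t0]. *)
Definition moving_center (R : realType) n (z0 w : 'rV[R]_n) (t0 t : R) :=
  z0 + (t0 - t) *: w.

(** With [s = r^2 - |m - c|^2], the Laplacian of [s^2] is [8 |m - c|^2 - 4 n s]. Near the sphere,
    where [s] is small, it is positive and pays for the terms linear in [s] created by the gradient
    and the motion; further inside, the decay rate [M] does. The comparison takes place in the
    closed ball, so no cut-off is made outside. *)
Definition barrier (R : realType) n (z0 w : 'rV[R]_n) (r e M t0 t1 : R)
    (m : 'rV[R]_n) (t : R) :=
  e * expR (- M * (t - t1)) *
  (r ^+ 2 - dot (m - moving_center z0 w t0 t) (m - moving_center z0 w t0 t)) ^+ 2.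

Section BarrierDerivatives.
Variables (R : realType) (n : nat) (z0 w : 'rV[R]_n) (r e M t0 t1 : R).
Let phi := barrier z0 w r e M t0 t1.
Let c := moving_center z0 w t0.
Let s m t := r ^+ 2 - dot (m - c t) (m - c t).
Let E t := e * expR (- M * (t - t1)).

Lemma is_derive_dot_sub (x y v : 'rV[R]_n) :
  is_derive x v (fun x => dot (x - y) (x - y)) (2 * dot (x - y) v).
Proof.
have h := is_derive_dot_shift (x - y) v (0 : R).
rewrite scale0r addr0 in h; have [d1 d2] := h.
have F : (fun h : R =>
        h^-1 *: (dot (x - y + (h *: (1 : R) + 0) *: v) (x - y + (h *: (1 : R) + 0) *: v)
        - dot (x - y + (0 : R) *: v) (x - y + (0 : R) *: v))) =
  (fun h => h^-1 *: (((fun x => dot (x - y) (x - y)) \o shift x) (h *: v) - dot (x - y) (x - y))).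
  apply/funext => k /=; rewrite [k *: 1]mulr1 addr0 scale0r addr0.
  by rewrite [x - y + _]addrC addrA.
by apply: DeriveDef; [rewrite /derivable -F|rewrite /derive -F].
Qed.

Lemma barrier_d1 i (m : 'rV[R]_n) t :
  is_derive m 'e_i (phi ^~ t) (E t * (- 4 * s m t * (m - c t) ord0 i)).
Proof.
have h := is_derive_dot_sub m (c t) 'e_i; rewrite dot_delta in h.
have g := is_deriveB (is_derive_cst (r ^+ 2) m 'e_i) h.
apply: (is_derive_congr (is_deriveZ (E t) (is_deriveM g g))) => [x|].
  by rewrite /phi /barrier expr2.
by rewrite /GRing.scale /= -[(_ - _) m]/(s m t); ring.
Qed.

Lemma barrier_d2 i (m : 'rV[R]_n) t :
  is_derive m 'e_i (fun m => E t * (- 4 * s m t * (m - c t) ord0 i))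
    (E t * (8 * ((m - c t) ord0 i) ^+ 2 - 4 * s m t)).
Proof.
have h := is_derive_dot_sub m (c t) 'e_i; rewrite dot_delta in h.
have g := is_deriveB (is_derive_cst (r ^+ 2) m 'e_i) h.
have k : is_derive m 'e_i (fun m => (m - c t) ord0 i) 1.
  have k1 : is_derive m 'e_i (fun m => m - c t) ('e_i).
    by have := is_deriveB (is_derive_id m 'e_i) (is_derive_cst (c t) m 'e_i); rewrite subr0.
  apply: DeriveDef; first by case: k1 => /derivable_mxP/(_ ord0 i).
  have := @derive_mx _ _ _ _ _ m 'e_i (@ex_derive _ _ _ _ _ _ _ k1).
  rewrite (@derive_val _ _ _ _ _ _ _ k1) => /matrixP/(_ ord0 i).
  by rewrite !mxE !eqxx => <-.
apply: (is_derive_congr (is_deriveZ (E t) (is_deriveM (is_deriveZ (- 4) g) k))) => //.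
rewrite /GRing.scale /= -[(_ - _) m]/(s m t) -[- 4 *: _]/(- 4 * s m t); ring.
Qed.

Lemma barrier_dt (m : 'rV[R]_n) t :
  is_derive t (1 : R) (phi m)
    (E t * (- M * (s m t) ^+ 2 - 4 * s m t * dot (m - c t) w)).
Proof.
have cE t' : m - c t' = (m - z0 - t0 *: w) + t' *: w.
  by rewrite /c /moving_center scalerBl opprD opprB !addrA addrAC.
have h := is_derive_dot_shift (m - z0 - t0 *: w) w t; rewrite -cE in h.
have g : is_derive t (1 : R) (s m) (- (2 * dot (m - c t) w)).
  apply: (is_derive_congr (is_deriveB (is_derive_cst (r ^+ 2) t (1 : R)) h)) => [t'|].
    by rewrite /s cE.
  by rewrite sub0r.
have e1 : is_derive t (1 : R) (fun t => expR (- M * (t - t1)))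
    (expR (- M * (t - t1)) * (- M * (1 - 0))).
  have e0 : is_derive t (1 : R) (fun t => - M * (t - t1)) (- M * (1 - 0)).
    exact: (is_deriveZ (- M) (is_deriveB (is_derive_id t (1 : R)) (is_derive_cst t1 t (1 : R)))).
  exact: is_derive_comp_real (is_derive_expR _) e0.
apply: (is_derive_congr (is_deriveM (is_deriveZ e e1) (is_deriveM g g))) => [t'|].
  by rewrite /phi /barrier expr2.
rewrite -[(s m * s m) t]/(s m t * s m t) -[X in X *: (_ + _)]/(E t).
rewrite -[X in _ + _ *: X]/(e * (expR (- M * (t - t1)) * (- M * (1 - 0)))).
by rewrite /GRing.scale /= /E; ring.
Qed.

End BarrierDerivatives.

(** * Continuity and compactness for the Euclidean norm *)

Lemma continuous_add (R : realType) (T : topologicalType) (V : normedModType R)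
    (f g : T -> V) : continuous f -> continuous g -> continuous (fun x => f x + g x).
Proof. by move=> cf cg x; apply: cvgD; [exact: cf|exact: cg]. Qed.

Lemma continuous_scale (R : realType) (T : topologicalType) (V : normedModType R)
    (f : T -> R) (g : T -> V) :
  continuous f -> continuous g -> continuous (fun x => f x *: g x).
Proof. by move=> cf cg x; apply: cvgZ; [exact: cf|exact: cg]. Qed.

Lemma continuous_fun_comp (S T U : topologicalType) (f : S -> T) (g : T -> U) :
  continuous f -> continuous g -> continuous (fun x => g (f x)).
Proof. by move=> cf cg x; apply: continuous_comp; [exact: cf|exact: cg]. Qed.

Lemma continuous_sum_sqr (R : realType) (T : topologicalType) n (f : 'I_n -> T -> R) :
  (forall i, continuous (f i)) -> continuous (fun x => \sum_i f i x * f i x).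
Proof.
move=> cf x; apply: cvg_big => [|i _]; first exact: add_continuous.
by apply: cvgM; exact: cf.
Qed.

Lemma continuous_dot (R : realType) n : continuous (fun x : 'rV[R]_n => dot x x).
Proof.
have h := @continuous_sum_sqr R 'rV[R]_n n (fun i x => x ord0 i)
  (fun i => @coord_continuous R 1 n ord0 i).
have -> // : (fun x : 'rV[R]_n => dot x x) = (fun x => \sum_i x ord0 i * x ord0 i).
by apply/funext => x; rewrite dotE.
Qed.

Lemma norm_le_dot (R : realType) n (x : 'rV[R]_n) (r : R) :
  0 <= r -> dot x x <= r ^+ 2 -> `|x| <= r.
Proof.
move=> r0 xr; rewrite [leLHS]/Num.Def.normr/= mx_normrE.
by apply: bigmax_le => // -[i j] _ /=; rewrite ord1 coord_le_dot.
Qed.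

Lemma compact_dot_ball (R : realType) n (r : R) :
  0 <= r -> compact [set x : 'rV[R]_n | dot x x <= r ^+ 2].
Proof.
move=> r0; apply: bounded_closed_compact.
  exists r; split; first exact: num_real.
  by move=> k rk x /= xr; rewrite (le_trans _ (ltW rk))// norm_le_dot.
have -> : [set x : 'rV[R]_n | dot x x <= r ^+ 2] =
    (fun x => dot x x) @^-1` [set y | y <= r ^+ 2] by [].
by apply: preimage_closed => [x _|]; [exact: continuous_dot|exact: closed_le].
Qed.

Lemma near_lt_is_derive (R : realType) (f : R -> R) (x df c : R) :
  is_derive x (1 : R) f df -> f x < c -> \forall s \near x, f s <= c.
Proof.
move=> [fd _] fc.
have /differentiable_continuous cf : differentiable f x by exact/derivable1_diffP.
by apply: filterS (cvgr_lt (f x) cf c fc) => s /ltW.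
Qed.

(* [C >= barrier] on the moving ball: the term [N |d - d0|^2] turns the
   degenerate direction [d] into a parameter, and [barrier] vanishes on the
   lateral boundary. *)
Lemma log_strict_of_tube (R : realType) n (Omega : set 'rV[R]_n) (T : R)
    (a : 'rV[R]_n -> R) (v : 'rV[R]_n -> R -> R)
    (z0 w d0 : 'rV[R]_n) (t0 t1 r e l B U : R) :
  let X d m := m + (1 - l) *: d in
  let Y d m := m - l *: d in
  let C m d t := v m t - (l * v (X d m) t + (1 - l) * v (Y d m) t) in
  let c := moving_center z0 w t0 in
  let near_path m d t := dot (m - c t) (m - c t) <= r ^+ 2 /\
    dot (d - d0) (d - d0) <= r ^+ 2 in
  open Omega -> log_solution Omega T a v ->
  {within Omega `*` `]0, T[, continuous (fun z => v z.1 z.2)} ->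
  0 < t1 -> t1 < t0 -> t0 < T -> 0 < r -> 0 < e -> 0 < l < 1 -> 0 <= B ->
  (forall m d t, t1 <= t <= t0 -> near_path m d t ->
    [/\ Omega m, Omega (X d m), Omega (Y d m),
        l * a (X d m) + (1 - l) * a (Y d m) <= a m & 0 <= C m d t]) ->
  (forall m d t, t1 <= t <= t0 -> near_path m d t ->
    [/\ forall i, `|'D_('e_i) (v ^~ t) (X d m)| <= B,
        forall i, `|'D_('e_i) (v ^~ t) (Y d m)| <= B & expR (v m t) <= U]) ->
  (forall m d, near_path m d t1 -> e <= C m d t1) ->
  0 < C z0 d0 t0.
Proof.
move=> X Y C c near_path oO sol vc t10 t1t0 t0T r0 e0 l01 B0 tube bounds init.
have r20 : 0 < r ^+ 2 by exact: exprn_gt0.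
have r40 : 0 < r ^+ 4 by exact: exprn_gt0.
have c0 : c t0 = z0 by rewrite /c /moving_center subrr scale0r addr0.
have dot0 : dot (0 : 'rV[R]_n) 0 = 0.
  by rewrite dotE big1// => i _; rewrite mxE mul0r.
have path0 : near_path z0 d0 t0.
  by rewrite /near_path c0 !subrr dot0; split; exact: ltW.
have t10' : t1 <= t0 <= t0 by rewrite lexx ltW.
have U0 : 0 < U.
  by have [_ _] := bounds _ _ _ t10' path0; apply: lt_le_trans; exact: expR_gt0.
(* Since [s <= r^2], the barrier is then at most [e], the lower bound of the defect at time [t1]. *)
pose eps := e / r ^+ 4.
have eps0 : 0 < eps by rewrite divr_gt0.
(* For [|d - d0| = r] the penalty equals [eps r^4], an upper bound of the barrier. *)
pose N := eps * r ^+ 2.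
have N0 : 0 < N by rewrite mulr_gt0.
(* Coefficient of [s] in the final inequality: [8 + 4 n] comes from the Laplacian of the barrier,
   the next term from its gradient and the last from the motion of the centre. *)
pose A := 8 + 4 * n%:R + 8 * B * (n%:R * r) + 4 * (r * \sum_i `|w ord0 i|).
pose K := 4 * N / (l * (1 - l)) + U.
(* [K] absorbs the terms of order zero; the excess over [K] is what [barrier_discriminant]
   requires. *)
pose M := K + (A ^+ 2 + 1) / (16 * r ^+ 2).
have [l0 l1] : 0 < l /\ 0 < 1 - l by case/andP: l01; rewrite subr_gt0.
have M0 : 0 < M.
  have K0 : 0 < K by rewrite ltr_wpDl// divr_ge0// mulr_ge0// ltW.
  by rewrite ltr_wpDr// divr_ge0 ?addr_ge0 ?sqr_ge0// mulr_ge0 ?sqr_ge0.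
pose phi := barrier z0 w r eps M t0 t1.
pose E t := eps * expR (- M * (t - t1)).
have E0 t : 0 < E t by rewrite mulr_gt0 ?expR_gt0.
have Eeps t : t1 <= t -> E t <= eps.
  move=> t1t; rewrite ler_piMr ?(ltW eps0)// expR_le1.
  by rewrite mulNr oppr_le0 mulr_ge0 ?subr_ge0// ltW.
pose s m t := r ^+ 2 - dot (m - c t) (m - c t).
have phiE m t : phi m t = E t * s m t ^+ 2 by [].
pose G m d t := C m d t - phi m t + N * dot (d - d0) (d - d0).
rewrite ltNge; apply/negP => Cneg.
have addKl (p q : 'rV[R]_n) : p + q - p = q by rewrite addrAC subrr add0r.
pose ball_r := [set x : 'rV[R]_n | dot x x <= r ^+ 2].
(* In the coordinates [m - c t] and [d - d0] the moving tube is a fixed product, hence compact. *)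
pose D := (ball_r `*` ball_r) `*` `[t1, t0].
have cD : compact D.
  apply: compact_setX; last exact: segment_compact.
  by apply: compact_setX; apply: compact_dot_ball; exact: ltW.
pose pm (x : 'rV[R]_n * 'rV[R]_n * R) := c x.2 + x.1.1.
pose G' (x : 'rV[R]_n * 'rV[R]_n * R) := G (pm x) (d0 + x.1.2) x.2.
have Dpath x : D x -> t1 <= x.2 <= t0 /\ near_path (pm x) (d0 + x.1.2) x.2.
  move=> [[/= h1 h2]]; rewrite in_itv/= => h3; split=> //.
  by rewrite /near_path /pm !addKl.
have cG : {within D, continuous G'}.
  have vcomp (g : 'rV[R]_n * 'rV[R]_n * R -> 'rV[R]_n) : continuous g ->
      (forall x, D x -> Omega (g x)) -> {within D, continuous (fun x => v (g x) x.2)}.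
    move=> cg gD; apply: (@within_continuous_comp _ _ _ D _ (fun x => (g x, x.2)) _ _ _ vc).
      by apply: continuous_pair => // x; exact: cvg_snd.
    move=> x Dx; split=> /=; first exact: gD.
    have [/andP[x1 x2] _] := Dpath x Dx.
    by rewrite in_itv/= (lt_le_trans t10 x1) (le_lt_trans x2 t0T).
  have cpm : continuous pm.
    apply: continuous_add; last exact: continuous_fst_fst.
    apply: continuous_add; first by move=> x; exact: cvg_cst.
    apply: continuous_scale; last by move=> x; exact: cvg_cst.
    by move=> x; apply: cvgB; [exact: cvg_cst|exact: cvg_snd].
  have cd : continuous (fun x : 'rV[R]_n * 'rV[R]_n * R => d0 + x.1.2).
    by apply: continuous_add; [move=> x; exact: cvg_cst|exact: continuous_fst_snd].
  have c1 : {within D, continuous (fun x => v (pm x) x.2)}.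
    by apply: vcomp => // x /Dpath[h1 h2]; have [] := tube _ _ _ h1 h2.
  have c2 : {within D, continuous (fun x => v (X (d0 + x.1.2) (pm x)) x.2)}.
    apply: vcomp => [|x /Dpath[h1 h2]]; last by have [] := tube _ _ _ h1 h2.
    apply: continuous_add; first exact: cpm.
    by apply: continuous_scale; [move=> x; exact: cvg_cst|exact: cd].
  have c3 : {within D, continuous (fun x => v (Y (d0 + x.1.2) (pm x)) x.2)}.
    apply: vcomp => [|x /Dpath[h1 h2]]; last by have [] := tube _ _ _ h1 h2.
    rewrite /Y; under eq_fun do rewrite -scaleNr.
    apply: continuous_add; first exact: cpm.
    by apply: continuous_scale; [move=> x; exact: cvg_cst|exact: cd].
  have c4 : {within D, continuous (fun x => E x.2 * (r ^+ 2 - dot x.1.1 x.1.1) ^+ 2 )}.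
    apply: continuous_subspaceT => x; apply: cvgM.
      apply: cvgM; first exact: cvg_cst.
      apply: continuous_cvg; first exact: continuous_expR.
      apply: cvgM; first exact: cvg_cst.
      by apply: cvgB; [exact: cvg_snd|exact: cvg_cst].
    have cs : r ^+ 2 - dot y.1.1 y.1.1 @[y --> x] --> r ^+ 2 - dot x.1.1 x.1.1.
      apply: cvgB; first exact: cvg_cst.
      exact: (continuous_fun_comp (@continuous_fst_fst _ _ _) (@continuous_dot R n)).
    under eq_fun do rewrite expr2; rewrite expr2.
    exact: (cvgM cs cs).
  have c5 : {within D, continuous (fun x => N * dot x.1.2 x.1.2)}.
    apply: continuous_subspaceT => x; apply: cvgM; first exact: cvg_cst.
    exact: (continuous_fun_comp (@continuous_fst_snd _ _ _) (@continuous_dot R n)).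
  have -> : G' = (fun x => v (pm x) x.2 - (l * v (X (d0 + x.1.2) (pm x)) x.2
       + (1 - l) * v (Y (d0 + x.1.2) (pm x)) x.2)
       - E x.2 * (r ^+ 2 - dot x.1.1 x.1.1) ^+ 2 + N * dot x.1.2 x.1.2).
    apply/funext => x; rewrite /G' /G phiE /s /pm.
    by rewrite !addKl.
  move=> x; apply: cvgD; last exact: c5.
  apply: cvgB; last exact: c4.
  apply: cvgB; first exact: c1.
  by apply: cvgD; (apply: cvgM; first exact: cvg_cst); [exact: c2|exact: c3].
have D0 : D (0, 0, t0).
  by split; [split; rewrite /ball_r /= dot0 ltW|rewrite /= in_itv].
have [x /set_mem Dx Gmin] := compact_EVT_min (ex_intro _ _ D0) cD cG.
have [tt pth] := Dpath x Dx.
pose m := pm x; pose d := d0 + x.1.2; pose t := x.2.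
rewrite -/m -/d -/t in tt pth.
have minG m' d' t' : t1 <= t' <= t0 -> near_path m' d' t' -> G m d t <= G m' d' t'.
  move=> tt' [h1 h2].
  have D' : D (m' - c t', d' - d0, t') by split; [split|rewrite /= in_itv].
  have := Gmin _ (mem_set D'); rewrite /G' /pm /=.
  by rewrite ![_ + (_ - _)]addrC !subrK.
have Gneg : G m d t < 0.
  apply: le_lt_trans (minG z0 d0 t0 t10' path0) _.
  rewrite /G subrr dot0 mulr0 addr0 subr_lt0 (le_lt_trans Cneg)//.
  by rewrite phiE /s c0 subrr dot0 subr0 mulr_gt0// exprn_gt0.
have [t1t tt0] := andP tt; have [pth1 pth2] := pth.
have [Om OX OY aC C0] := tube m d t tt pth.
have [BX BY mU] := bounds m d t tt pth.
have Nd0 : 0 <= N * dot (d - d0) (d - d0) by rewrite mulr_ge0 ?dot_ge0// ltW.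
have s_le : s m t <= r ^+ 2 by rewrite lerBlDr lerDl dot_ge0.
have s_ge0 : 0 <= s m t by rewrite subr_ge0.
have phi_le : phi m t <= eps * r ^+ 4.
  rewrite phiE; apply: ler_pM; rewrite ?sqr_ge0 ?(ltW (E0 t))// ?Eeps//.
  have -> : r ^+ 4 = (r ^+ 2) ^+ 2 by rewrite -exprM.
  by rewrite ler_pXn2r// nnegrE// ltW.
(* [G < 0] is impossible on the rest of the parabolic boundary too: on the sphere the barrier
   vanishes, for [|d - d0| = r] the penalty dominates it, and at [t1] the initial bound does. *)
have s_gt0 : 0 < s m t.
  rewrite lt_neqAle s_ge0 andbT eq_sym; apply/eqP => s0.
  by move: Gneg; rewrite /G phiE s0 expr0n mulr0 subr0 ltNge addr_ge0.
have d_lt : dot (d - d0) (d - d0) < r ^+ 2.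
  rewrite lt_neqAle pth2 andbT; apply/eqP => dr.
  move: Gneg; rewrite /G dr ltNge -addrA addr_ge0// addrC subr_ge0.
  by rewrite (le_trans phi_le)// /N -mulrA -exprD.
have t_gt : t1 < t.
  rewrite lt_neqAle t1t andbT; apply/eqP => t_1.
  move: Gneg; rewrite /G ltNge addr_ge0// subr_ge0 (le_trans phi_le)//.
  rewrite /eps divfK ?gt_eqF// -t_1; apply: init; by rewrite t_1.
have t0T' : 0 < t < T by rewrite (lt_trans t10 t_gt) (le_lt_trans tt0 t0T).
have h := @barrier_inequality R n Omega T a v phi
  (fun i m => E t * (- 4 * s m t * (m - c t) ord0 i))
  (fun i => E t * (8 * ((m - c t) ord0 i) ^+ 2 - 4 * s m t))
  (E t * (- M * s m t ^+ 2 - 4 * s m t * dot (m - c t) w))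
  m d d0 t l N B U oO sol Om OX OY t0T' l01 aC.
have {}h := h (fun i m => barrier_d1 z0 w r eps M t0 t1 i m t)
  (fun i => barrier_d2 z0 w r eps M t0 t1 i m t)
  (barrier_dt z0 w r eps M t0 t1 m t) (ltW N0) C0 Gneg BX BY mU.
have xi_lt : dot (m - c t) (m - c t) < r ^+ 2 by rewrite -subr_gt0.
have /h{}h : forall i, \forall s \near (0 : R), G m d t <= G (m + s *: 'e_i) d t.
  move=> i; have := near_lt_is_derive (c := r ^+ 2) (is_derive_dot_shift (m - c t) 'e_i 0).
  rewrite scale0r addr0 => /(_ xi_lt); apply: filterS => s' hs; apply: minG => //.
  by split=> //; rewrite addrAC.
have /h{}h : forall i, \forall s \near (0 : R), G m d t <= G m (d + s *: 'e_i) t.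
  move=> i; have := near_lt_is_derive (c := r ^+ 2) (is_derive_dot_shift (d - d0) 'e_i 0).
  rewrite scale0r addr0 => /(_ d_lt); apply: filterS => s' hs; apply: minG => //.
  by split=> //; rewrite addrAC.
(* Here [m] stays fixed while the ball moves; slightly earlier times are admissible because [m] is
   strictly inside the ball at time [t]. *)
have /h{}h : \forall s \near t^'-, G m d t <= G m d s.
  have cE t' : m - c t' = (m - z0 - t0 *: w) + t' *: w.
    by rewrite /c /moving_center scalerBl opprD opprB !addrA addrAC.
  have := near_lt_is_derive (c := r ^+ 2) (is_derive_dot_shift (m - z0 - t0 *: w) w t).
  rewrite -cE => /(_ xi_lt) H; near=> t'; apply: minG.
    have -> : t1 <= t' by apply: ltW; near: t'; exact: nbhs_left_gt.
    by rewrite (le_trans _ tt0)//; near: t'; exact: nbhs_left_le.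
  by split=> //; rewrite cE; near: t'; exact: cvg_within H.
set xi := m - c t in h.
have xir i : `|xi ord0 i| <= r by apply: coord_le_dot pth1; exact: ltW.
have rho : \sum_i xi ord0 i ^+ 2 = r ^+ 2 - s m t.
  rewrite /s opprB addrCA subrr addr0 dotE; apply: eq_bigr => i _.
  by rewrite expr2.
rewrite phiE -/K in h.
move: (E t) (E0 t) (s m t) s_gt0 rho h => q q0 y y0 rho h.
have S2 : \sum_i q * (8 * xi ord0 i ^+ 2 - 4 * y) =
    q * (8 * (r ^+ 2 - y) - 4 * n%:R * y).
  rewrite -mulr_sumr sumrB sumr_const card_ord -mulr_natr -mulr_sumr rho.
  ring.
have S1 : \sum_i `|q * (- 4 * y * xi ord0 i)| <= q * (4 * y * (n%:R * r)).
  apply: (@le_trans _ _ (\sum_(i < n) q * (4 * y * r))).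
    apply: ler_sum => i _; rewrite normrM (gtr0_norm q0) ler_pM2l//.
    have y4 : 0 < 4 * y by rewrite mulr_gt0.
    by rewrite normrM mulNr normrN (gtr0_norm y4) ler_pM2l.
  rewrite sumr_const card_ord -mulr_natr le_eqVlt; apply/orP; left; apply/eqP; ring.
have Sw : - dot xi w <= r * \sum_i `|w ord0 i|.
  rewrite dotE mulr_sumr -sumrN; apply: ler_sum => i _.
  by rewrite (le_trans (ler_norm _))// normrN normrM ler_wpM2r.
rewrite S2 in h.
(* With the bounds [S1] and [Sw], dividing [h] by [q] gives [(M - K) y^2 - A y + 8 r^2 <= 0], which
   the choice of [M] excludes. *)
have sx := @barrier_discriminant R r A y r0.
have : 0 < q * ((A ^+ 2 + 1) / (16 * r ^+ 2) * y ^+ 2 - A * y + 8 * r ^+ 2).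
  by rewrite mulr_gt0.
have MK : M = K + (A ^+ 2 + 1) / (16 * r ^+ 2) by [].
set H := (A ^+ 2 + 1) / _ in MK *.
rewrite MK in h.
have b1 : 2 * B * \sum_i `|q * (- 4 * y * xi ord0 i)| <= 2 * B * (q * (4 * y * (n%:R * r))).
  by rewrite ler_wpM2l// mulr_ge0.
have b2 : q * y * (- dot xi w) <= q * y * (r * \sum_i `|w ord0 i|).
  by rewrite ler_pM2l// mulr_gt0.
move: (\sum_i `|q * _|) b1 h => b b1 h.
rewrite /A; clearbody H K; lra.
Unshelve. all: by end_near. Qed.

(** * Strict concavity: conclusion *)

(** [b] is the supremum of the parameters whose point lies in Omega: finite because Omega is
    bounded, above 1 because Omega is open at [x], and approached without gaps because Omega is
    convex. *)
Lemma exit_point (R : realType) (V : normedModType R) (Omega : set V) (x y : V) :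
  open Omega -> bounded_set Omega ->
  (forall x y l, Omega x -> Omega y -> 0 <= l <= 1 -> Omega (segment_point x y l)) ->
  Omega x -> Omega y -> x != y ->
  exists b : R, [/\ 1 < b, boundary Omega (y + b *: (x - y)) &
    forall s, 0 <= s < b -> Omega (y + s *: (x - y))].
Proof.
move=> oO bO cvx Ox Oy xy; set d := x - y.
have d0 : 0 < `|d| by rewrite normr_gt0 subr_eq0.
pose S := [set s : R | 0 <= s /\ Omega (y + s *: d)].
have S1 : S 1 by split=> //; rewrite scale1r addrC subrK.
have [k k0 Ok] : exists2 k : R, 0 < k & forall z, Omega z -> `|z| <= k.
  have /ex_strict_bound_gt0[k k0 Ok] := bO.
  by exists k => // z /Ok /ltW.
have ubS : ubound S ((k + `|y|) / `|d|).
  move=> s [s0 Os]; rewrite ler_pdivlMr//.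
  have -> : s * `|d| = `|(y + s *: d) - y| by rewrite addrAC subrr add0r normrZ ger0_norm.
  by rewrite (le_trans (ler_normB _ _))// lerD2r Ok.
have hs : has_sup S by split; [exists 1|exists ((k + `|y|) / `|d|)].
pose b := sup S.
have Sle s : S s -> s <= b by move=> Ss; apply: sup_upper_bound.
have Slt s : 0 <= s -> s < b -> Omega (y + s *: d).
  move=> s0 sb; have bs : 0 < b - s by rewrite subr_gt0.
  have [s' [s'0 Os'] ss'] := sup_adherent bs hs.
  rewrite -/b subKr in ss'.
  have s'gt0 : 0 < s' by exact: le_lt_trans ss'.
  have := cvx _ _ (s / s') Os' Oy; rewrite /segment_point.
  have -> : (s / s') *: (y + s' *: d) + (1 - s / s') *: y = y + s *: d.
    rewrite scalerDr addrAC -scalerDl addrCA subrr addr0 scale1r scalerA divfK//.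
    by rewrite gt_eqF.
  by apply; rewrite divr_ge0// ?ler_pdivrMr// ?mul1r ltW// ltW.
have openS s : Omega (y + s *: d) -> exists2 e : R, 0 < e & Omega (y + (s + e) *: d).
  move=> Os; have H := near_line_open d oO Os.
  near (0 : R)^'+ => e; exists e => //.
  by rewrite scalerDl addrA; near: e; exact: cvg_within H.
have bgt1 : 1 < b.
  have [e e0 Oe] := openS 1 S1.2.
  by apply: (@lt_le_trans _ _ (1 + e)); rewrite ?ltrDl// Sle//; split=> //; rewrite addr_ge0// ltW.
have b0 : 0 < b by exact: lt_trans bgt1.
exists b; split=> //; last by move=> s /andP[s0 sb]; exact: Slt.
split; last first.
  move=> /interior_subset /openS[e e0 Oe].
  have /Sle : S (b + e) by split=> //; rewrite addr_ge0// ltW.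
  by rewrite gerDl leNgt e0.
move=> B nB.
have cont : y + s *: d @[s --> b] --> y + b *: d.
  by apply: cvgD; [exact: cvg_cst|apply: cvgZr_tmp; exact: cvg_id].
have nB' : \forall s \near b^'-, B (y + s *: d).
  by apply: cvg_within; exact: cont.
near b^'- => s; exists (y + s *: d); split; last by near: s.
apply: Slt; first by apply: ltW; near: s; exact: nbhs_left_gt.
by near: s; exact: nbhs_left_lt.
Unshelve. all: by end_near. Qed.

Lemma dot_add_le (R : realType) n (x y : 'rV[R]_n) :
  dot (x + y) (x + y) <= 2 * dot x x + 2 * dot y y.
Proof.
rewrite !dotE !mulr_sumr -big_split /=; apply: ler_sum => i _; rewrite !mxE.
have := sqr_ge0 (x ord0 i - y ord0 i); lra.
Qed.

Lemma dotZ (R : realType) n (k : R) (x : 'rV[R]_n) :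
  dot (k *: x) (k *: x) = k ^+ 2 * dot x x.
Proof.
by rewrite !dotE mulr_sumr; apply: eq_bigr => i _; rewrite !mxE; ring.
Qed.

Lemma open_prod (S T : topologicalType) (A : set S) (B : set T) :
  open A -> open B -> open (A `*` B).
Proof.
move=> oA oB; rewrite openE => -[x y] [/= Ax By]; exists (A, B) => //=.
by split; exact: open_nbhs_nbhs.
Qed.

Lemma continuous_slice (R : realType) (V : normedModType R) (A : set V)
    (T t : R) (v : V -> R -> R) (x : V) :
  open A -> {within A `*` `]0, T[, continuous (fun z => v z.1 z.2)} ->
  A x -> 0 < t < T -> {for x, continuous (v ^~ t)}.
Proof.
move=> oA; rewrite continuous_open_subspace; last first.
  by apply: open_prod => //; exact: interval_open.
move=> cv Ax t0T.
have Axt : (x, t) \in A `*` `]0, T[ by rewrite inE; split; rewrite //= in_itv.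
have cp : continuous (fun y : V => (y, t)).
  by apply: continuous_pair => z; [exact: cvg_id|exact: cvg_cst].
apply: (@continuous_comp _ _ _ (fun y => (y, t)) (fun z => v z.1 z.2)).
  exact: cp.
exact: cv.
Qed.

Lemma continuous_defect (R : realType) (V : normedModType R) (v : V -> R)
    (m d : V) (l : R) :
  {for m, continuous v} -> {for m + (1 - l) *: d, continuous v} ->
  {for m - l *: d, continuous v} ->
  {for (m, d), continuous (fun p : V * V =>
    v p.1 - (l * v (p.1 + (1 - l) *: p.2) + (1 - l) * v (p.1 - l *: p.2)))}.
Proof.
move=> c1 c2 c3.
have cX k : {for (m, d), continuous (fun p : V * V => p.1 + k *: p.2)}.
  by apply: cvgD; [exact: cvg_fst|apply: cvgZl_tmp; exact: cvg_snd].
apply: cvgB.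
  by apply: (@continuous_comp _ _ _ fst v) => //; exact: cvg_fst.
apply: cvgD; (apply: cvgM; first exact: cvg_cst).
  by apply: (@continuous_comp _ _ _ (fun p : V * V => p.1 + (1 - l) *: p.2) v) => //; exact: cX.
apply: (@continuous_comp _ _ _ (fun p : V * V => p.1 - l *: p.2) v) => //.
by apply: cvgB; [exact: cvg_fst|apply: cvgZl_tmp; exact: cvg_snd].
Qed.

Lemma log_defect_gt0 (R : realType) (p q s l : R) :
  0 < p -> 0 < q -> 0 < s -> 0 < s - `|p| `^ l * `|q| `^ (1 - l) ->
  l * ln p + (1 - l) * ln q < ln s.
Proof.
move=> p0 q0 s0; rewrite subr_gt0 /powR !normr_eq0 !gt_eqF//.
by rewrite !gtr0_norm// -expRD => h; rewrite -ltr_expR (lnK s0).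
Qed.

(* The geometric mean of [u] vanishes when the first point reaches the boundary,
   so strict inequality holds for suitable translates of [x] and [y]. *)
Lemma strict_near_exit (R : realType) n (Omega : set 'rV[R]_n) (T b t l : R)
    (u : 'rV[R]_n -> R -> R) (y d : 'rV[R]_n) :
  {within closure Omega `*` `[0, T], continuous (fun z => u z.1 z.2)} ->
  (forall x t, Omega x -> 0 <= t <= T -> 0 < u x t) ->
  (forall x t, boundary Omega x -> 0 <= t <= T -> u x t = 0) ->
  0 <= t <= T -> 0 < l < 1 -> 1 < b -> boundary Omega (y + b *: d) ->
  (forall s, 0 <= s < b -> Omega (y + s *: d)) ->
  exists s, [/\ 0 <= s, 1 + s < b &
    l * ln (u (y + (1 + s) *: d) t) + (1 - l) * ln (u (y + s *: d) t)
      < ln (u (y + (l + s) *: d) t)].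
Proof.
move=> cu up ub tT /andP[l0 l1] b1 bb Ob.
pose pt s := y + s *: d.
have clb s : 0 <= s <= b -> closure Omega (pt s).
  move=> /andP[s0]; rewrite le_eqVlt => /predU1P[->|sb]; first by case: bb.
  by apply: subset_closure; apply: Ob; rewrite s0.
(* Translation by [b - 1] brings the leading point to the exit parameter [b]. Writing [0 + s] gives
   the three terms the common shape treated by [cuk]. *)
pose h s := u (pt (l + s)) t - `|u (pt (1 + s)) t| `^ l * `|u (pt (0 + s)) t| `^ (1 - l).
have cpt k : continuous (fun s => pt (k + s)).
  move=> s; apply: cvgD; first exact: cvg_cst.
  by apply: cvgZr_tmp; apply: cvgD; [exact: cvg_cst|exact: cvg_id].
have cuk k : 0 <= k <= 1 -> {within `[0, b - 1], continuous (fun s => u (pt (k + s)) t)}.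
  move=> /andP[k0 k1].
  apply: (@within_continuous_comp _ _ _ _ _ (fun s => (pt (k + s), t)) _ _ _ cu).
    by apply: continuous_pair; [exact: cpt|move=> s; exact: cvg_cst].
  move=> s; rewrite /= in_itv/= => /andP[s0 s1]; split; last by rewrite /= in_itv.
  by apply: clb; rewrite addr_ge0//=; lra.
have ch : {within `[0, b - 1], continuous h}.
  move=> s; apply: cvgB; first by apply: cuk; rewrite !ltW.
  apply: cvgM.
    apply: (@continuous_comp _ _ _ _ (fun r : R => `|r| `^ l));
      last exact: continuous_norm_powR.
    by apply: cuk; rewrite lexx ler01.
  apply: (@continuous_comp _ _ _ _ (fun r : R => `|r| `^ (1 - l))); last first.
    by apply: continuous_norm_powR; rewrite subr_gt0.
  by apply: cuk; rewrite lexx ler01.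
have hb : 0 < h (b - 1).
  rewrite /h [1 + _]addrC subrK (ub _ _ bb tT) normr0 (powR0 (lt0r_neq0 l0)) mul0r subr0.
  by apply: up => //; apply: Ob; apply/andP; split; lra.
have b10 : 0 < b - 1 by rewrite subr_gt0.
have Hn : \forall s \near b - 1, 0 <= s <= b - 1 -> 0 < h s.
  have /subspace_continuousP/(_ (b - 1)) := ch.
  rewrite /= in_itv/= lexx ltW// => /(_ isT) /cvgr_gt/(_ _ hb) H.
  by move: H; rewrite near_withinE; apply: filterS => s /=; rewrite in_itv.
(* Stopping just before [b - 1] keeps the leading point in Omega, where its logarithm is
   meaningful. *)
near (b - 1)^'- => s.
have s0 : 0 < s by near: s; exact: nbhs_left_gt.
have sb : s < b - 1 by near: s; exact: nbhs_left_lt.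
exists s; split; [exact: ltW|by rewrite addrC -ltrBrDr|].
apply: log_defect_gt0.
- by apply: up => //; apply: Ob; apply/andP; split; lra.
- by apply: up => //; apply: Ob; apply/andP; split; lra.
- by apply: up => //; apply: Ob; apply/andP; split; lra.
have : 0 <= s <= b - 1 -> 0 < h s by near: s; exact: cvg_within Hn.
by rewrite /h add0r; apply; rewrite !ltW.
Unshelve. all: by end_near. Qed.

Lemma log_strictly_concave (R : realType) n (Omega : set 'rV[R]_n) (T Bu : R)
    (a : 'rV[R]_n -> R) (u : 'rV[R]_n -> R -> R) :
  open Omega -> bounded_set Omega ->
  (forall x y l, Omega x -> Omega y -> 0 <= l <= 1 -> Omega (segment_point x y l)) ->
  {within closure Omega `*` `[0, T], continuous (fun z => u z.1 z.2)} ->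
  log_solution Omega T a (fun x t => ln (u x t)) ->
  (forall x t, Omega x -> 0 <= t <= T -> 0 < u x t) ->
  (forall x t, boundary Omega x -> 0 <= t <= T -> u x t = 0) ->
  (forall x y l, Omega x -> Omega y -> 0 < l < 1 ->
    l * a x + (1 - l) * a y <= a (segment_point x y l)) ->
  (forall x t i, Omega x -> 0 < t < T ->
    derivable (u ^~ t) x 'e_i /\ `|'D_('e_i) (u ^~ t) x| <= Bu) ->
  (forall x y t l, Omega x -> Omega y -> 0 < t < T -> 0 < l < 1 ->
    l * ln (u x t) + (1 - l) * ln (u y t) <= ln (u (segment_point x y l) t)) ->
  forall x y t l, Omega x -> Omega y -> x != y -> 0 < t < T -> 0 < l < 1 ->
    l * ln (u x t) + (1 - l) * ln (u y t) < ln (u (segment_point x y l) t).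
Proof.
move=> oO bO cvx cu sol up ub ac ud conc x y t0 l Ox Oy xy /andP[t00 t0T] l01.
have [l0 l1] := andP l01.
pose t1 := t0 / 2.
have t10 : 0 < t1 by rewrite divr_gt0.
have t1t0 : t1 < t0 by rewrite /t1; lra.
pose d0 := x - y.
have [b [b1 bb Ob]] := exit_point oO bO cvx Ox Oy xy.
rewrite -/d0 in bb Ob.
have t1T : 0 <= t1 <= T by rewrite ltW//= ltW// (lt_trans t1t0).
have [s1 [s10 s1b strict1]] := strict_near_exit cu up ub t1T l01 b1 bb Ob.
pose v x t := ln (u x t).
pose pt s := y + s *: d0.
have vc : {within Omega `*` `]0, T[, continuous (fun z => v z.1 z.2)}.
  have /subspace_continuousP cu' : {within Omega `*` `]0, T[, continuous (fun z => u z.1 z.2)}.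
    apply: continuous_subspaceW cu => -[p s] [/= Op]; rewrite in_itv/= => /andP[s0 sT].
    by split; [exact: subset_closure|rewrite /= in_itv/= !ltW].
  apply/subspace_continuousP => -[p s] Ops; apply: continuous_cvg; last exact: cu'.
  apply: continuous_ln; case: Ops => /= Op; rewrite in_itv/= => /andP[s0 sT].
  by apply: up; rewrite // !ltW.
(* The axis of the tube: along it the three points travel with parameters between 0 and [1 + s1]. *)
pose Kseg := pt @` `[0, 1 + s1].
have cpt : continuous pt.
  apply: continuous_add; first by move=> s; exact: cvg_cst.
  by apply: continuous_scale => s; [exact: cvg_id|exact: cvg_cst].
have cKseg : compact Kseg.
  by apply: continuous_compact; [exact: continuous_subspaceT|exact: segment_compact].
have KsegO : Kseg `<=` Omega.
  move=> _ [s + <-]; rewrite /= in_itv/= => /andP[s0 s1s].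
  by apply: Ob; rewrite s0 (le_lt_trans s1s).
have [rho rho0 Hrho] := compact_open_thickening cKseg oO KsegO.
(* A compact neighbourhood of the axis inside Omega. For times in [[t1, t0]], [u] is bounded away
   from 0 on it, so a gradient bound for [u] yields one for [ln u]. *)
pose Kc := (fun p : 'rV[R]_n * 'rV[R]_n => p.1 + p.2) @`
  (Kseg `*` [set z | dot z z <= rho ^+ 2]).
have cKc : compact Kc.
  apply: continuous_compact.
    apply: continuous_subspaceT; apply: continuous_add => p; [exact: cvg_fst|exact: cvg_snd].
  by apply: compact_setX => //; apply: compact_dot_ball; exact: ltW.
have KcO : Kc `<=` Omega.
  move=> _ [[k z] [/= Kk zr] <-]; apply: (Hrho k) => //=.
  by rewrite opprD addrA subrr add0r normrN norm_le_dot// ltW.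
have inKc s z : 0 <= s <= 1 + s1 -> dot z z <= rho ^+ 2 -> Kc (pt s + z).
  move=> s01 zr; exists (pt s, z) => //; split=> //.
  by exists s => //; rewrite /= in_itv.
pose DK := Kc `*` `[t1, t0].
have cDK : compact DK by apply: compact_setX => //; exact: segment_compact.
have cuDK : {within DK, continuous (fun z => u z.1 z.2)}.
  apply: continuous_subspaceW cu => -[p s] [/= Kp]; rewrite in_itv/= => /andP[s0 sT].
  split; first by apply: subset_closure; exact: KcO.
  by rewrite /= in_itv/= (le_trans _ s0) ?(ltW t10)//= (le_trans sT)// ltW.
have DK0 : DK (pt 0 + 0, t0).
  split=> /=; last by rewrite in_itv/= lexx ltW.
  apply: inKc; first by rewrite lexx addr_ge0.
  by rewrite dotE big1 ?sqr_ge0// => i _; rewrite mxE mul0r.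
have [[pm tm] /set_mem[/= Kpm tmI] umin] := compact_EVT_min (ex_intro _ _ DK0) cDK cuDK.
have [[pM tM] _ umax] := compact_EVT_max (ex_intro _ _ DK0) cDK cuDK.
rewrite /= in umin umax.
have c0 : 0 < u pm tm.
  apply: up; first exact: KcO.
  move: tmI; rewrite in_itv/= => /andP[h1 h2].
  by rewrite (le_trans (ltW t10) h1) (le_trans h2)// ltW.
(* [x != y] excludes dimension 0, so [Bu] bounds at least one absolute value. *)
have Bu0 : 0 <= Bu.
  have [[i _]|n0] := pselect (exists i : 'I_n, True); last first.
    exfalso; move/eqP: xy; apply; apply/rowP => i; exfalso; apply: n0; by exists i.
  have tt : 0 < t0 < T by rewrite t00.
  by have [_ h] := ud x t0 i Ox tt; apply: le_trans h.
have gradv p t i : Kc p -> t1 <= t <= t0 -> `|'D_('e_i) (v ^~ t) p| <= Bu / u pm tm.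
  move=> Kp /andP[h1 h2]; have Op := KcO _ Kp.
  have tT : 0 < t < T by rewrite (lt_le_trans t10)// (le_lt_trans h2).
  have [d1 d2] := ud p t i Op tT.
  have up0 : 0 < u p t by apply: up => //; case/andP: tT => /ltW -> /ltW ->.
  have := is_derive_comp_real (is_derive1_ln up0) (derivableP d1).
  move=> /(@derive_val _ _ _ _ _ _ _) ->.
  rewrite normrM mulrC ler_pM// gtr0_norm ?invr_gt0// lef_pV2 ?posrE//.
  by apply: (umin (p, t)); rewrite inE; split; rewrite //= in_itv/= h1.
pose X d m : 'rV[R]_n := m + (1 - l) *: d.
pose Y d m : 'rV[R]_n := m - l *: d.
pose C m d t := v m t - (l * v (X d m) t + (1 - l) * v (Y d m) t).
have Xpt s : X d0 (pt (l + s)) = pt (1 + s).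
  rewrite /X /pt -addrA -scalerDl; congr (_ + _ *: _); ring.
have Ypt s : Y d0 (pt (l + s)) = pt s.
  rewrite /Y /pt -addrA -scaleNr -scalerDl; congr (_ + _ *: _); ring.
have t1T' : 0 < t1 < T by rewrite t10 (lt_trans t1t0).
have C1 : 0 < C (pt (l + s1)) d0 t1.
  by rewrite /C Xpt Ypt subr_gt0.
have Ol1 : Omega (pt (l + s1)).
  by apply: Ob; rewrite addr_ge0 ?(ltW l0)// (lt_trans _ s1b)// ltrD2r.
have cC : {for (pt (l + s1), d0), continuous (fun p => C p.1 p.2 t1)}.
  apply: (@continuous_defect R _ (v ^~ t1)).
  - exact: continuous_slice oO vc Ol1 t1T'.
  - apply: continuous_slice oO vc _ t1T'; rewrite -/(X d0 (pt (l + s1))) Xpt.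
    by apply: Ob; rewrite addr_ge0.
  - apply: continuous_slice oO vc _ t1T'; rewrite -/(Y d0 (pt (l + s1))) Ypt.
    by apply: Ob; rewrite s10 (lt_trans _ s1b)// ltrDr.
(* Half of the defect at the starting configuration leaves room for a neighbourhood of it in
   [(m, d)]. *)
pose e := C (pt (l + s1)) d0 t1 / 2.
have e0 : 0 < e by rewrite divr_gt0.
have eC : e < C (pt (l + s1)) d0 t1 by rewrite /e ltr_pdivrMr// ltr_pMr// ltr1n.
have Hn : \forall p \near (pt (l + s1), d0), e < C p.1 p.2 t1.
  exact: (cvgr_gt (C (pt (l + s1)) d0 t1) cC e eC).
have /nbhs_ballP[del /= del0 Hdel] := Hn.
(* [rho / 2] keeps the perturbed points in [Kc], since [|xi + k de|^2 <= 2 r^2 + 2 r^2 <= rho^2]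
   when [k^2 <= 1]; [del / 2] keeps the initial ball where the defect exceeds [e]. *)
pose r := Num.min (rho / 2) (del / 2).
have r0 : 0 < r by rewrite lt_min !divr_gt0.
have r_rho : r <= rho / 2 by rewrite ge_min lexx.
have r_del : r < del.
  have : r <= del / 2 by rewrite ge_min lexx orbT.
  by lra.
(* The centre runs from [pt (l + s1)] at time [t1] to [pt l], the point of the claim, at time [t0];
   [sg t] below is the translation that remains. *)
pose w := (s1 / (t0 - t1)) *: d0.
have dt0 : 0 < t0 - t1 by rewrite subr_gt0.
pose sg t := (t0 - t) * (s1 / (t0 - t1)).
have cE t : moving_center (pt l) w t0 t = pt (l + sg t).
  by rewrite /moving_center /w scalerA /pt -addrA -scalerDl.
have sg01 t : t1 <= t <= t0 -> 0 <= sg t <= s1.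
  move=> /andP[h1 h2]; rewrite /sg mulr_ge0 ?subr_ge0 ?divr_ge0 ?(ltW dt0)//=.
  by rewrite mulrCA ler_piMr// ler_pdivrMr// mul1r lerD2l lerN2.
have sg1 : sg t1 = s1 by rewrite /sg mulrCA divff ?mulr1// gt_eqF.
have pathK m d t : t1 <= t <= t0 ->
    dot (m - moving_center (pt l) w t0 t) (m - moving_center (pt l) w t0 t) <= r ^+ 2 ->
    dot (d - d0) (d - d0) <= r ^+ 2 -> [/\ Kc m, Kc (X d m) & Kc (Y d m)].
  move=> tt; rewrite cE; set xi := m - _; set de := d - d0 => h1 h2.
  have /andP[g0 g1] := sg01 t tt.
  have mE : m = pt (l + sg t) + xi by rewrite addrC subrK.
  have dE : d = d0 + de by rewrite addrC subrK.
  have r4 : 4 * r ^+ 2 <= rho ^+ 2.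
    have : r ^+ 2 <= (rho / 2) ^+ 2 by rewrite ler_pXn2r// nnegrE ltW// divr_gt0.
    by rewrite expr_div_n ler_pdivlMr// mulrC -natrX.
  have rr : 0 <= r ^+ 2 by exact: sqr_ge0.
  have kk k : k ^+ 2 <= 1 -> dot (xi + k *: de) (xi + k *: de) <= rho ^+ 2.
    move=> k1; apply: le_trans (dot_add_le _ _) _; rewrite dotZ.
    have : k ^+ 2 * dot de de <= 1 * r ^+ 2 by apply: ler_pM; rewrite ?sqr_ge0 ?dot_ge0.
    by rewrite mul1r; move: h1 r4 => {}h1 {}r4 h3; clear -h1 r4 h3 rr; lra.
  split.
  - rewrite mE; apply: inKc; first by rewrite addr_ge0 ?(ltW l0)// lerD// ltW.
    by rewrite (le_trans h1)// (le_trans _ r4)// ler_peMl// ler1n.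
  - have -> : X d m = pt (1 + sg t) + (xi + (1 - l) *: de).
      by rewrite -Xpt /X [in LHS]mE [in LHS]dE scalerDr addrACA.
    apply: inKc; first by rewrite addr_ge0// lerD2l.
    by apply: kk; rewrite expr_le1 ?subr_ge0 ?(ltW l1)// lerBlDr lerDl ltW.
  - have -> : Y d m = pt (sg t) + (xi + (- l) *: de).
      rewrite -Ypt /Y [in LHS]mE [in LHS]dE scalerDr opprD scaleNr.
      by rewrite addrACA.
    apply: inKc; first by rewrite g0 (le_trans g1)// lerDr.
    by apply: kk; rewrite sqrrN expr_le1// ltW.
have C0 : 0 < C (pt l) d0 t0.
  apply: (@log_strict_of_tube R n Omega T a v (pt l) w d0 t0 t1 r e l
    (Bu / u pm tm) (u pM tM)) => //.
  - by rewrite divr_ge0// ltW.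
  - move=> m d t tt [h1 h2]; have [Km KX KY] := pathK m d t tt h1 h2.
    have tT : 0 < t < T by case/andP: tt => h3 h4; rewrite (lt_le_trans t10)// (le_lt_trans h4).
    have mE : segment_point (X d m) (Y d m) l = m.
      rewrite /segment_point /X /Y !scalerDr addrACA -scalerDl.
      have -> : l + (1 - l) = 1 by rewrite addrCA subrr addr0.
      by rewrite scale1r scalerN !scalerA [(1 - l) * l]mulrC subrr addr0.
    split; [exact: KcO|exact: KcO|exact: KcO| |].
      by rewrite -[X in _ <= a X]mE; apply: ac => //; exact: KcO.
    rewrite /C subr_ge0 -[X in _ <= v X _]mE.
    by apply: conc => //; exact: KcO.
  - move=> m d t tt [h1 h2]; have [Km KX KY] := pathK m d t tt h1 h2.
    split=> [i|i|]; [exact: gradv|exact: gradv|].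
    rewrite /v lnK; last first.
      rewrite posrE; apply: up; first exact: KcO.
      by case/andP: tt => h3 h4; rewrite (le_trans (ltW t10))// (le_trans h4)// ltW.
    by apply: (umax (m, t)); rewrite inE; split; rewrite //= in_itv.
  - move=> m d [h1 h2]; apply: ltW; apply: (Hdel (m, d)).
    rewrite cE sg1 in h1.
    (* The ball of [Hdel] is taken in the sup norm, which the Euclidean norm dominates. *)
    by split; rewrite -ball_normE /= distrC (le_lt_trans _ r_del)// norm_le_dot// ltW.
move: C0; rewrite /C -[in X d0 _](addr0 l) -[in Y d0 _](addr0 l) Xpt Ypt subr_gt0.
rewrite /v /pt addr0 scale1r scale0r addr0 /d0 [y + (x - y)]addrC subrK.
congr (_ < ln (u _ _)).
by rewrite /segment_point scalerBr addrC addrAC scalerBl scale1r addrA.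
Unshelve. all: by end_near. Qed.

(** * Bounds for the coefficient and the gradient *)

Lemma closure_prod (S T : topologicalType) (A : set S) (B : set T) :
  closure A `*` closure B `<=` closure (A `*` B).
Proof.
move=> [x y] [/= cx cy] P [[Q1 Q2] [/= n1 n2] QP].
have [x' [Ax' Qx']] := cx _ n1; have [y' [By' Qy']] := cy _ n2.
by exists (x', y'); split=> //; exact: QP.
Qed.

(** The regularity of [u] is stated on the closure of a product with []0, T[], while the compactness
    arguments use [[0, T]]. A point is approached from inside by moving it slightly towards
    [T / 2]. *)
Lemma closure_itv_oo (R : realType) (T : R) : 0 < T -> `[0, T] `<=` closure `]0, T[.
Proof.
move=> T0 s; rewrite /= in_itv/= => /andP[s0 sT] B nB.
have cont : s + h * (T / 2 - s) @[h --> (0 : R)] --> s.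
  have : s + h * (T / 2 - s) @[h --> (0 : R)] --> s + 0 * (T / 2 - s).
    by apply: cvgD; [exact: cvg_cst|apply: cvgM; [exact: cvg_id|exact: cvg_cst]].
  by rewrite mul0r addr0.
have nB' : \forall h \near (0 : R)^'+, B (s + h * (T / 2 - s)).
  by apply: cvg_within; exact: cont.
near (0 : R)^'+ => h; exists (s + h * (T / 2 - s)); split; last by near: h.
have h0 : 0 < h by [].
have h1 : h < 1 by near: h; apply: nbhs_right_lt.
rewrite /= in_itv/=.
have -> : s + h * (T / 2 - s) = (1 - h) * s + h * (T / 2) by ring.
have hT : 0 < h * (T / 2) by rewrite mulr_gt0// divr_gt0.
have h1' : 0 <= 1 - h by rewrite subr_ge0 ltW.
rewrite ltr_wpDl ?mulr_ge0//=.
apply: (@le_lt_trans _ _ ((1 - h) * T + h * (T / 2))).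
  by rewrite lerD2r ler_wpM2l.
rewrite mulrBl mul1r -addrA gtrDl addrC subr_lt0 ltr_pM2l//.
by rewrite ltr_pdivrMr// ltr_pMr// ltr1n.
Unshelve. all: by end_near. Qed.

Lemma bounded_closure_compact (R : realType) n (A : set 'rV[R]_n) :
  bounded_set A -> compact (closure A).
Proof.
move=> bA; apply: bounded_closed_compact; last exact: closed_closure.
have [k _ Ak] := ex_strict_bound_gt0 bA.
exists k; split; first exact: num_real.
move=> k' kk' x /= cx; rewrite leNgt; apply/negP => k'x.
have [|y [Ay]] := cx [set y | k' < `|y|].
  have cn : {for x, continuous (fun y : 'rV[R]_n => `|y|)} by exact: norm_continuous.
  exact: (cvgr_gt _ cn k' k'x).
by rewrite /= ltNge => /negP; apply; rewrite (le_trans _ (ltW kk'))// ltW// Ak.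
Qed.

(* Reflecting [y] through the ball centred at [x0] writes [x0] as a fixed convex
   combination of [y] and a point of that ball. *)
Lemma concave_bounded_above (R : realType) (V : normedModType R) (Omega : set V)
    (a : V -> R) (x0 : V) (L : R) :
  bounded_set Omega ->
  (forall x y l, Omega x -> Omega y -> 0 < l < 1 ->
    l * a x + (1 - l) * a y <= a (segment_point x y l)) ->
  (\forall y \near x0, Omega y /\ L <= a y) ->
  exists K, forall y, Omega y -> a y <= K.
Proof.
move=> bO ac /nbhs_ballP[e /= e0 He].
have [k k0 Ok] := ex_strict_bound_gt0 bO.
have Ox0 : Omega x0 by have [] := He x0 (ballxx _ e0).
pose D := k + k; have D0 : 0 < D by exact: addr_gt0.
have Dle y : Omega y -> `|y - x0| < D.
  by move=> Oy; rewrite (le_lt_trans (ler_normB _ _))// ltrD// Ok.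
(* [del] keeps the reflected point [x0 - del (y - x0)] in the ball for every [y] of Omega, and [l]
   is the weight for which its combination with [y] is [x0]. *)
pose del := e / D; have del0 : 0 < del by exact: divr_gt0.
pose l := (1 + del)^-1.
have d1 : 0 < 1 + del by exact: addr_gt0.
have l01 : 0 < l < 1 by rewrite invr_gt0 d1 invf_lt1// ltrDl.
have [l0 l1] := andP l01.
have ld : 1 - l = l * del.
  by rewrite /l; field; rewrite gt_eqF.
exists ((a x0 - l * L) / (1 - l)) => y Oy.
rewrite ler_pdivlMr ?subr_gt0// lerBrDr.
pose x' := x0 - del *: (y - x0).
have [Ox' La] : Omega x' /\ L <= a x'.
  apply: He; rewrite -ball_normE /= opprB addrCA subrr addr0 normrZ gtr0_norm//.
  by rewrite -ltr_pdivlMl// /del invf_div divfK ?gt_eqF// Dle.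
have E : segment_point x' y l = x0.
  have -> : x' = (1 + del) *: x0 - del *: y.
    by rewrite /x' scalerBr opprB addrA scalerDl scale1r.
  by rewrite /segment_point ld scalerBr !scalerA subrK mulVf ?gt_eqF// scale1r.
have := ac _ _ l Ox' Oy l01; rewrite E; apply: le_trans.
by rewrite addrC [a y * _]mulrC lerD2r ler_pM2l.
Qed.

Lemma concave_on_segment (R : realType) (V : normedModType R) (A : set V) (f : V -> R) :
  concave_on A f -> forall x y l, A x -> A y -> 0 < l < 1 ->
  l * f x + (1 - l) * f y <= f (segment_point x y l).
Proof.
move=> cf x y l Ax Ay /andP[l0 l1].
have := cf (Itv01 (ltW l0) (ltW l1)) x y (mem_set Ax) (mem_set Ay).
rewrite convRE /= -[X in _ <= X]opprK !mulrN -opprD lerN2.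
by rewrite opprK.
Qed.

Lemma segment_concave_on (R : realType) (V : normedModType R) (A : set V) (f : V -> R) :
  (forall x y l, A x -> A y -> 0 < l < 1 ->
    l * f x + (1 - l) * f y <= f (segment_point x y l)) -> concave_on A f.
Proof.
move=> cf l x y /set_mem Ax /set_mem Ay.
have [->|l0] := eqVneq l 0%:i01; first by rewrite !conv0.
have [->|l1] := eqVneq l 1%:i01; first by rewrite !conv1.
rewrite convRE /= !mulrN -opprD lerN2; apply: cf => //.
by rewrite !lt_neqAle eq_sym l0 l1 ge0 le1.
Qed.

Lemma is_derive_slice_space (R : realType) (V : normedModType R) (u : V -> R -> R)
    (x v : V) (t df : R) :
  is_derive (x, t) (v, 0) (fun z => u z.1 z.2) df -> is_derive x v (u ^~ t) df.
Proof.
have E : (fun h : R =>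
      h^-1 *: (((fun z => u z.1 z.2) \o shift (x, t)) (h *: (v, 0 : R)) - u x t)) =
  (fun h => h^-1 *: ((u ^~ t \o shift x) (h *: v) - u x t)).
  by apply/funext => h /=; rewrite scaler0 add0r.
by move=> [d1 d2]; apply: DeriveDef; [rewrite /derivable -E|rewrite /derive -E].
Qed.

Lemma is_derive_slice_time (R : realType) (V : normedModType R) (u : V -> R -> R)
    (x : V) (t df : R) :
  is_derive (x, t) (0, 1) (fun z => u z.1 z.2) df -> is_derive t (1 : R) (u x) df.
Proof.
have E : (fun h : R =>
      h^-1 *: (((fun z => u z.1 z.2) \o shift (x, t)) (h *: (0 : V, 1 : R)) - u x t)) =
  (fun h => h^-1 *: ((u x \o shift t) (h *: (1 : R)) - u x t)).
  by apply/funext => h /=; rewrite scaler0 add0r.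
by move=> [d1 d2]; apply: DeriveDef; [rewrite /derivable -E|rewrite /derive -E].
Qed.

Lemma within_closure_continuous (S T : topologicalType) (A : set S) (f : S -> T) (x : S) :
  open A -> A x -> {within closure A, continuous f} -> {for x, continuous f}.
Proof.
move=> oA Ax cf; have : {within A, continuous f}.
  by apply: continuous_subspaceW cf; exact: subset_closure.
by rewrite continuous_open_subspace// => /(_ x (mem_set Ax)).
Qed.

Lemma continuous_quotient (R : realType) (S : topologicalType) n (g u : S -> R)
    (h : 'I_n -> S -> R) (x : S) :
  {for x, continuous g} -> {for x, continuous u} -> u x != 0 ->
  (forall i, {for x, continuous (h i)}) ->
  {for x, continuous (fun x => (g x - \sum_i h i x) / u x + u x)}.
Proof.
move=> cg cu u0 ch; apply: cvgD => //; apply: cvgM; last exact: cvgV.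
by apply: cvgB => //; apply: cvg_big => [|i _]; [exact: add_continuous|exact: ch].
Qed.

(* Solving the equation for [a] shows that it is continuous, hence locally
   bounded below. *)
Lemma coefficient_bounded_above (R : realType) n (Omega : set 'rV[R]_n) (T : R)
    (a : 'rV[R]_n -> R) (u : 'rV[R]_n -> R -> R) :
  open Omega -> bounded_set Omega -> 0 < T ->
  (forall t, 0 < t <= T -> Ck_closure 2 Omega (u ^~ t)) ->
  Ck_closure 1 (Omega `*` `]0, T[) (fun z => u z.1 z.2) ->
  (forall x t, Omega x -> 0 < t <= T -> 0 < u x t) ->
  (forall x t, Omega x -> 0 < t <= T ->
      time_derive `]0, T] u x t - laplacian (u ^~ t) x
        = a x * u x t - u x t ^+ 2) ->
  concave_on Omega a ->
  exists K, forall x, Omega x -> a x <= K.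
Proof.
move=> oO bO T0 uC2 uC1 up ueq ac.
have [[x0 Ox0]|nO] := pselect (exists x, Omega x); last first.
  by exists 0 => x Ox; exfalso; apply: nO; exists x.
(* As [a] does not depend on time, one interior time suffices. *)
pose t := T / 2.
have t0T : 0 < t < T by rewrite /t divr_gt0//= ltr_pdivrMr// ltr_pMr// ltr1n.
have t0T' : 0 < t <= T by case/andP: t0T => -> /ltW.
have oOT : open (Omega `*` `]0, T[) by apply: open_prod => //; exact: interval_open.
have [_ uC1'] := uC1.
have [ud [g gE [gc _]]] := uC1' (0, 1).
have OT x : Omega x -> (Omega `*` `]0, T[) (x, t).
  by move=> Ox; split; rewrite //= in_itv.
have tdu x : Omega x -> is_derive t (1 : R) (u x) (g (x, t)).
  move=> Ox; apply: is_derive_slice_time; rewrite (gE _ (OT x Ox)).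
  by apply: derivableP; apply: ud; exact: OT.
have gc' : {for x0, continuous (fun x => g (x, t))}.
  apply: (@continuous_slice R _ Omega T t (fun x t => g (x, t))) => //.
  have -> : (fun z : 'rV[R]_n * R => g (z.1, z.2)) = g by apply/funext => -[].
  by apply: continuous_subspaceW gc; exact: subset_closure.
have [uc uC2'] := uC2 t t0T'.
(* Continuity is given for extensions of the second derivatives; these are collected in [h]. *)
have /choice[h hP] : forall i : 'I_n, exists h : 'rV[R]_n -> R,
    {for x0, continuous h} /\ forall x, Omega x -> h x = 'D_('e_i) ('D_('e_i) (u ^~ t)) x.
  move=> i; have [_ [g1 g1E [_ C1]]] := uC2' 'e_i.
  have [_ [h hE [hc _]]] := C1 'e_i; exists h; split.
    exact: within_closure_continuous hc.
  move=> x Ox; rewrite hE//; apply: near_eq_derive.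
  by near=> y; apply: g1E; near: y; exact: open_nbhs_nbhs.
have ucx : {for x0, continuous (u ^~ t)} by exact: within_closure_continuous uc.
pose A x := (g (x, t) - \sum_i h i x) / u x t + u x t.
have aA x : Omega x -> a x = A x.
  move=> Ox; have u0 := up x t Ox t0T'.
  have := ueq x t Ox t0T'; rewrite time_derive_interior//; last first.
    by case: (tdu x Ox).
  rewrite (@derive_val _ _ _ _ _ _ _ (tdu x Ox)) /A.
  have -> : \sum_i h i x = laplacian (u ^~ t) x.
    by apply: eq_bigr => i _; rewrite (hP i).2.
  move=> ->; rewrite mulrBl mulfK ?gt_eqF// expr2 mulfK ?gt_eqF//.
  by rewrite subrK.
have Ac : {for x0, continuous A}.
  apply: continuous_quotient => //; first by rewrite gt_eqF// up.
  by move=> i; have [] := hP i.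
apply: (concave_bounded_above (x0 := x0) (L := A x0 - 1) bO (concave_on_segment ac)).
have Al : \forall y \near x0, A x0 - 1 < A y.
  by apply: (cvgr_gt (A x0) Ac); rewrite ltrBlDr ltrDl.
near=> y; have Oy : Omega y by near: y; exact: open_nbhs_nbhs.
by split=> //; rewrite aA// ltW//; near: y.
Unshelve. all: by end_near. Qed.

(** Each spatial derivative extends continuously to a compact set, so the bound is uniform up to the
    boundary and up to both end times. *)
Lemma gradient_bounded (R : realType) n (Omega : set 'rV[R]_n) (T : R)
    (u : 'rV[R]_n -> R -> R) :
  bounded_set Omega -> 0 < T ->
  Ck_closure 1 (Omega `*` `]0, T[) (fun z => u z.1 z.2) ->
  exists B, forall x t i, Omega x -> 0 < t < T ->
    derivable (u ^~ t) x 'e_i /\ `|'D_('e_i) (u ^~ t) x| <= B.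
Proof.
move=> bO T0 [_ uC1].
have cD : compact (closure Omega `*` `[0, T]).
  by apply: compact_setX; [exact: bounded_closure_compact|exact: segment_compact].
have DO : closure Omega `*` `[0, T] `<=` closure (Omega `*` `]0, T[).
  move=> [x t] [/= cx tT]; apply: closure_prod; split=> //=.
  exact: closure_itv_oo.
have /choice[b bP] : forall i : 'I_n, exists b : R, forall x t, Omega x -> 0 < t < T ->
    is_derive x 'e_i (u ^~ t) ('D_('e_i) (u ^~ t) x) /\ `|'D_('e_i) (u ^~ t) x| <= b.
  move=> i; have [ud [g gE [gc _]]] := uC1 ('e_i, 0).
  have {}gc : {within closure Omega `*` `[0, T], continuous g} by apply: continuous_subspaceW gc.
  have bg : bounded_set (g @` (closure Omega `*` `[0, T])).
    by apply: compact_bounded; exact: continuous_compact.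
  have [k k0 gk] := ex_strict_bound_gt0 bg.
  exists k => x t Ox t0T.
  have Oxt : (Omega `*` `]0, T[) (x, t) by split; rewrite //= in_itv.
  have d : is_derive x 'e_i (u ^~ t) (g (x, t)).
    by apply: is_derive_slice_space; rewrite gE//; apply: derivableP; exact: ud.
  have [d1 d2] := d; split; first exact: derivableP.
  rewrite d2 ltW//; apply: gk; exists (x, t) => //; split=> /=; first exact: subset_closure.
  by case/andP: t0T => t0 tT; rewrite in_itv/= !ltW.
exists (\sum_i `|b i|) => x t i Ox t0T; have [[d1 _] db] := bP i x t Ox t0T.
split=> //; rewrite (le_trans db)// (bigD1 i)//=.
by rewrite (le_trans (ler_norm _))// lerDl sumr_ge0.
Qed.

Theorem theorem1p3 (R : realType) (n : nat) (Omega : set 'rV[R]_n) (T : R)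
    (a u0 : 'rV[R]_n -> R) (u : 'rV[R]_n -> R -> R)
    (n_ge2 : (2 <= n)%N)
    (Omega_open : open Omega)
    (Omega_connected : connected Omega)
    (Omega_bounded : bounded_set Omega)
    (Omega_smooth : boundary_C2alpha Omega)
    (Omega_strongly_convex : strongly_convex Omega)
    (T_gt0 : 0 < T)
    (u0_C1 : Ck_closure 1 Omega u0)
    (u0_boundary : forall x, boundary Omega x -> u0 x = 0)
    (u_C2x : forall t, 0 < t <= T -> Ck_closure 2 Omega (u ^~ t))
    (u_C1 : Ck_closure 1 (Omega `*` `]0, T[) (fun z => u z.1 z.2))
    (u_positive : forall x t, Omega x -> 0 < t <= T -> 0 < u x t)
    (u_equation : forall x t, Omega x -> 0 < t <= T ->
      time_derive `]0, T] u x t - laplacian (u ^~ t) x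
        = a x * u x t - u x t ^+ 2)
    (u_boundary : forall x t, boundary Omega x -> 0 <= t <= T -> u x t = 0)
    (u_normal : forall x nu t, interior_normal Omega x nu -> 0 <= t <= T ->
      0 < dot (grad_ext Omega `]0, T[ u x t) nu)
    (u_initial : forall x, closure Omega x -> u x 0 = u0 x)
    (u0_log_concave : log_concave_on Omega u0)
    (a_concave : concave_on Omega a) :
  (forall t, 0 < t < T -> concave_on Omega (fun x => ln (u x t))) /\
  (C21 Omega `]0, T] (fun x _ => a x) -> C21 Omega `]0, T] u ->
   forall t, 0 < t < T -> strictly_concave_on Omega (fun x => ln (u x t))).
Proof.
have cvx x y l : Omega x -> Omega y -> 0 <= l <= 1 -> Omega (segment_point x y l).
  by move=> Ox Oy l01; exact: strongly_convex_segment.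
have cu : {within closure Omega `*` `[0, T], continuous (fun z => u z.1 z.2)}.
  have [uc _] := u_C1; apply: continuous_subspaceW uc => -[x t] [/= cx tT].
  by apply: closure_prod; split=> //=; exact: closure_itv_oo.
have [u0_gt0 u0_ln] := u0_log_concave.
(* At [t = 0] positivity comes from the log-concavity of [u0], which includes [u0 > 0] in Omega. *)
have u_gt0 x t : Omega x -> 0 <= t <= T -> 0 < u x t.
  move=> Ox /andP[]; rewrite le_eqVlt => /predU1P[<- _|t0 tT].
    by rewrite u_initial; [exact: u0_gt0|exact: subset_closure].
  by apply: u_positive; rewrite ?t0.
have sol : log_solution Omega T a (fun x t => ln (u x t)).
  apply: ln_log_solution => // x t Ox t0T.
  have [_ /(_ (0, 1))[ud _]] := u_C1.
  have Oxt : (Omega `*` `]0, T[) (x, t) by split; rewrite //= in_itv.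
  by have [] := is_derive_slice_time (derivableP (ud _ Oxt)).
have a_seg := concave_on_segment a_concave.
have [K aK] := coefficient_bounded_above Omega_open Omega_bounded T_gt0 u_C2x u_C1 u_positive
  u_equation a_concave.
have ini x y l : Omega x -> Omega y -> 0 < l < 1 ->
    l * ln (u x 0) + (1 - l) * ln (u y 0) <= ln (u (segment_point x y l) 0).
  move=> Ox Oy l01; rewrite !u_initial; try exact: subset_closure.
    exact: (concave_on_segment u0_ln).
  by apply: subset_closure; apply: cvx => //; case/andP: l01 => /ltW -> /ltW ->.
have conc := log_concave_preserved Omega_open cvx (bounded_closure_compact Omega_bounded) cu sol
  u_gt0 u_boundary ini a_seg aK.
split=> [t t0T|_ _ t t0T x y l Ox Oy xy l01].
  by apply: segment_concave_on => x y l Ox Oy l01; exact: conc.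
have [B uB] := gradient_bounded Omega_bounded T_gt0 u_C1.
exact: (log_strictly_concave Omega_open Omega_bounded cvx cu sol u_gt0 u_boundary a_seg uB conc).
Qed.
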